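(* Let $\phi$ be an odd set composition of $[n]$. Then $$\Delta^\circ(\boldsymbol\eta_\phi)=\sum_{\psi\le\phi}\mathbf M_\psi\otimes\Bigg(\sum_{\substack{\chi\le\xi\text{ for some }\xi\in\mathscr C_\phi^\psi\\ \chi\text{ odd}}}C_\chi^{\phi\psi}\,\boldsymbol\eta_\chi\Bigg),$$ where $\psi$ runs over set compositions of $[n]$ with $\psi\le\phi$ and $\chi$ over odd set compositions of $[n]$. In particular, $\mathrm{NC}\Pi$ is a left co-ideal of $\mathrm{NCQSym}$ under the internal coproduct, i.e. $\Delta^\circ(\mathrm{NC}\Pi)\subseteq\mathrm{NCQSym}\otimes\mathrm{NC}\Pi$.
   Context: Let $\mathbf x_1,\mathbf x_2,\dots$ be noncommuting variables over $\mathbb Q$, $[m]=\{1,\dots,m\}$. A set composition $\phi=\phi_1|\cdots|\phi_{\ell(\phi)}$ of $[n]$ is a sequence of disjoint nonempty sets with union $[n]$; it is odd if all blocks have odd size. $\psi\le\phi$ means each block of $\psi$ is a union of consecutive blocks of $\phi$. $\psi\wedge\chi$ is obtained from $\psi_1\cap\chi_1,\psi_1\cap\chi_2,\dots,\psi_{\ell(\psi)}\cap\chi_{\ell(\chi)}$ (lexicographic order) by deleting empty sets. $\mathbf M_\phi=\sum\mathbf x_{i_1}\cdots\mathbf x_{i_n}$ over tuples of positive integers with $i_j=i_k$ iff $j,k$ in the same block and $i_j<i_k$ iff the block of $j$ is left of that of $k$; $\mathrm{NCQSym}=\mathrm{span}\{\mathbf M_\phi\}$. The internal coproduct is the linear map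 $\Delta^\circ:\mathrm{NCQSym}\to\mathrm{NCQSym}\otimes\mathrm{NCQSym}$ with $\Delta^\circ(\mathbf M_\phi)=\sum_{\psi\wedge\varphi=\phi}\mathbf M_\psi\otimes\mathbf M_\varphi$. For odd $\phi$ of $[n]$, $p(\phi)=(n-\ell(\phi))/2$ and $\boldsymbol\eta_\phi=(-1)^{p(\phi)}\sum_{\psi\le\phi}2^{\ell(\psi)}\mathbf M_\psi$. $\mathscr C_\phi^\psi=\{\phi_{\tau(1)}|\cdots|\phi_{\tau(\ell(\phi))}:\tau\in\mathfrak S_{\ell(\phi)},\ \psi\wedge(\phi_{\tau(1)}|\cdots|\phi_{\tau(\ell(\phi))})=\phi\}$. Let $\mu$ be the Möbius function of the poset of odd set compositions of $[n]$ under $\le$. For odd $\chi$ with $\chi\le\xi$ for some $\xi\in\mathscr C_\phi^\psi$, $C_\chi^{\phi\psi}=(-1)^{p(\chi)+p(\phi)}\sum_{\zeta}\mu(\chi,\zeta)2^{\ell(\psi\wedge\zeta)-\ell(\zeta)}$, summed over odd set compositions $\zeta$ with $\chi\le\zeta\le\xi$ for some $\xi\in\mathscr C_\phi^\psi$. $\mathrm{NC}\Pi$ is the span of all $\mathbf K_{(P,\gamma,\sigma)}=\sum_f\mathbf x_{|f(\sigma^{-1}(1))|}\cdots\mathbf x_{|f(\sigma^{-1}(n))|}$, where $P$ is a poset on an $n$-set $X$, $\gamma,\sigma:X\to[n]$ bijections, and $f$ ranges over maps $X\to\mathbb Z\setminus\{0\}$ such that for $a\le b$: $f(a)\preceq f(b)$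 in the order $-1\prec1\prec-2\prec2\prec\cdots$, $f(a)=f(b)>0\Rightarrow\gamma(a)<\gamma(b)$, $f(a)=f(b)<0\Rightarrow\gamma(a)>\gamma(b)$; the $\boldsymbol\eta_\phi$ ($\phi$ odd) lie in $\mathrm{NC}\Pi$ and form a basis of it. *)

(* Defs.v *)
From HB Require Import structures.
From mathcomp Require Import all_boot all_order all_algebra.
From mathcomp Require Import all_classical.

Set Implicit Arguments.
Unset Strict Implicit.
Unset Printing Implicit Defensive.

Import Order.TTheory GRing.Theory Num.Theory.
Local Open Scope ring_scope.

(* Conventions: [n] is 'I_n (0-based).  The variable x_i, i >= 1, is the      *)
(* letter i, a monomial x_{i_1} ... x_{i_n} is the word [:: i_1; ...; i_n],   *)
(* and a formal series is the function giving the coefficient of each word.   *)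

(** * Set compositions *)

Section SetCompositions.
Variable I : finType.
Implicit Types s t : seq {set I}.

Definition is_setcomp s : bool :=
  [&& finset.set0 \notin s, pairwise (fun A B : {set I} => [disjoint A & B]) s
    & (\bigcup_(B <- s) B == [set: I])%SET].

Definition join_blocks s : {set I} := (\bigcup_(B <- s) B)%SET.

(* The blocks of [s] are, from left to right, the unions of the consecutive   *)
(* segments into which [t] is cut.                                            *)
Definition coarser s t : Prop :=
  exists ss : seq (seq {set I}),
    flatten ss = t /\ [seq join_blocks u | u <- ss] = s.

Definition wedge_seq s t : seq {set I} :=
  [seq C <- [seq (A :&: B)%SET | A <- s, B <- t] | C != finset.set0].

Lemma size_disjoint_blocks s : finset.set0 \notin s ->
  pairwise (fun A B : {set I} => [disjoint A & B]) s ->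
  (size s <= #|\bigcup_(B <- s) B|%SET)%N.
Proof.
elim: s => [|A s IHs] //=; rewrite inE negb_or => /andP[A0 s0] /andP[dA ds].
rewrite big_cons.
have dAs : [disjoint A & (\bigcup_(B <- s) B)%SET].
  elim: s dA {IHs s0 ds} => [|B s IHs] /=.
    by rewrite big_nil -setI_eq0 finset.setI0.
  case/andP=> dAB /IHs dA; rewrite big_cons disjoint_sym.
  by rewrite -setI_eq0 finset.setIUl finset.setU_eq0 !setI_eq0 !(disjoint_sym _ A) dAB.
rewrite cardsU disjoint_setI0 // cards0 subn0 -add1n leq_add ?IHs //.
by rewrite card_gt0 eq_sym.
Qed.

Lemma coarser_refl s : coarser s s.
Proof.
exists [seq [:: B] | B <- s]; split; first exact: flatten_seq1.
rewrite -map_comp -[RHS]map_id; apply: eq_map => B /=.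
by rewrite /join_blocks big_seq1.
Qed.

Lemma join_blocks_flatten (ss : seq (seq {set I})) :
  join_blocks (flatten ss) = join_blocks [seq join_blocks u | u <- ss].
Proof.
rewrite /join_blocks; elim: ss => [|u ss IHss] /=; first by rewrite !big_nil.
by rewrite big_cat big_cons /= IHss.
Qed.

Lemma coarser_trans s t r : coarser s t -> coarser t r -> coarser s r.
Proof.
case=> ss [fss jss] [tt [ftt jtt]].
have szt : size tt = sumn (shape ss).
  by rewrite -size_flatten fss -jtt size_map.
exists [seq flatten u | u <- reshape (shape ss) tt]; split.
  have flatten2 (T : Type) (uu : seq (seq (seq T))) :
      flatten [seq flatten u | u <- uu] = flatten (flatten uu).
    by elim: uu => //= u uu ->; rewrite flatten_cat.
  by rewrite flatten2 reshapeKr ?szt.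
rewrite -jss -map_comp.
under eq_map do rewrite /= join_blocks_flatten.
rewrite (map_comp join_blocks (map join_blocks)) map_reshape jtt -fss.
by rewrite flattenK.
Qed.

Lemma coarser_size s t : finset.set0 \notin s -> coarser s t ->
  (size s <= size t)%N /\ (size t <= size s -> s = t)%N.
Proof.
move=> s0 [ss [<- jss]]; rewrite -jss in s0 *; move: s0 => {jss s t}.
elim: ss => //= u ss IHss; rewrite inE negb_or => /andP[u0 /IHss[le_s eq_s]].
have u1 : (0 < size u)%N.
  by case: u u0 => //; rewrite /join_blocks big_nil eqxx.
rewrite size_cat size_map; rewrite size_map in le_s eq_s; split.
  by rewrite -add1n leq_add.
move=> le_us; have {u1} : size u = 1%N.
  apply/eqP; rewrite eqn_leq u1 andbT -(leq_add2r (size ss)) add1n.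
  by apply: leq_trans le_us; rewrite leq_add2l.
case: u u0 le_us => [|B [|? ?]] //= _ le_us _.
by rewrite eq_s // /join_blocks big_seq1.
Qed.

End SetCompositions.

Record setcomp (n : nat) : predArgType := SetComp {
  blocks :> seq {set 'I_n};
  setcompP : is_setcomp blocks }.

HB.instance Definition _ n := [isSub for @blocks n].
HB.instance Definition _ n := [Choice of setcomp n by <:].

Lemma setcomp_set0 n (phi : setcomp n) : finset.set0 \notin blocks phi.
Proof. by case/and3P: (setcompP phi). Qed.

Lemma setcomp_size n (phi : setcomp n) : (size phi <= n)%N.
Proof.
case/and3P: (setcompP phi) => s0 ds _.
apply: leq_trans (size_disjoint_blocks s0 ds) _.
by apply: leq_trans (max_card _) _; rewrite card_ord.
Qed.

Definition setcomp_bseq n (phi : setcomp n) : n.-bseq {set 'I_n} :=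
  Bseq (setcomp_size phi).

Lemma setcomp_bseqK n :
  pcancel (@setcomp_bseq n) (fun s : n.-bseq _ => insub (s : seq {set 'I_n})).
Proof. by move=> phi; rewrite valK. Qed.

HB.instance Definition _ n :=
  Countable.copy (setcomp n) (pcan_type (@setcomp_bseqK n)).
HB.instance Definition _ n : isFinite (setcomp n) :=
  PCanIsFinite (@setcomp_bseqK n).

Fact setcomp_display : Order.disp_t. Proof. exact: Order.Disp tt tt. Qed.

Definition setcomp_le n (psi phi : setcomp n) : bool := `[< coarser psi phi >].

Lemma setcomp_le_refl n : reflexive (@setcomp_le n).
Proof. by move=> phi; apply/asboolP; exact: coarser_refl. Qed.

Lemma setcomp_le_anti n : antisymmetric (@setcomp_le n).
Proof.
move=> psi phi /andP[/asboolP le1 /asboolP le2]; apply: val_inj => /=.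
have [_] := coarser_size (setcomp_set0 psi) le1; apply.
by have [] := coarser_size (setcomp_set0 phi) le2.
Qed.

Lemma setcomp_le_trans n : transitive (@setcomp_le n).
Proof.
move=> phi psi chi /asboolP le1 /asboolP le2.
by apply/asboolP; exact: coarser_trans le1 le2.
Qed.

HB.instance Definition _ n :=
  Order.Le_isPOrder.Build setcomp_display (setcomp n)
    (@setcomp_le_refl n) (@setcomp_le_anti n) (@setcomp_le_trans n).

Definition odd_blocks n (phi : setcomp n) : bool :=
  all (fun B : {set 'I_n} => odd #|B|) phi.

Record oddcomp (n : nat) : predArgType := OddComp {
  oddcomp_val :> setcomp n;
  oddcompP : odd_blocks oddcomp_val }.

HB.instance Definition _ n := [isSub for @oddcomp_val n].
HB.instance Definition _ n := [Finite of oddcomp n by <:].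
HB.instance Definition _ n :=
  [SubChoice_isSubPOrder of oddcomp n by <: with setcomp_display].

Lemma oddcomp_leE n (chi zeta : oddcomp n) :
  (chi <= zeta)%O = (oddcomp_val chi <= oddcomp_val zeta)%O.
Proof. by []. Qed.

Lemma wedge_subproof n (psi chi : setcomp n) : is_setcomp (wedge_seq psi chi).
Proof.
case/and3P: (setcompP psi) => _ d1 /eqP c1.
case/and3P: (setcompP chi) => _ d2 /eqP c2.
apply/and3P; split; first by rewrite mem_filter eqxx.
- apply: pairwise_filter; elim: (blocks psi) d1 => //= A s IHs /andP[dA ds].
  rewrite pairwise_cat IHs // andbT; apply/andP; split.
    apply/allrelP => _ _ /mapP[B _ ->] /allpairsP[[A' B'] /= [A's _ ->]].
    have dAA' := allP dA _ A's.
    apply: disjointWl (subsetIl _ _) _; apply: disjointWr (subsetIl _ _) _.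
    exact: dAA'.
  rewrite pairwise_map; apply: sub_pairwise d2 => B B' dBB' /=.
  by apply: disjointWl (subsetIr _ _) _; apply: disjointWr (subsetIr _ _) _.
- rewrite finset.eqEsubset finset.subsetT; apply/fintype.subsetP => i _.
  have mem_cover (s : seq {set 'I_n}) :
      (i \in (\bigcup_(B <- s) B)%SET) = has (fun B : {set _} => i \in B) s.
    elim: s => [|B s IHs]; first by rewrite big_nil inE.
    by rewrite big_cons inE /= IHs.
  have /hasP[A As iA] : has (fun B : {set _} => i \in B) psi.
    by rewrite -mem_cover c1 inE.
  have /hasP[B Bs iB] : has (fun B : {set _} => i \in B) chi.
    by rewrite -mem_cover c2 inE.
  rewrite mem_cover; apply/hasP; exists (A :&: B)%SET; last by rewrite inE iA.
  rewrite mem_filter; apply/andP; split.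
    by apply/set0Pn; exists i; rewrite inE iA.
  by apply/allpairsP; exists (A, B).
Qed.

Definition wedge n (psi chi : setcomp n) : setcomp n :=
  SetComp (wedge_subproof psi chi).

(** * Möbius function of a finite poset *)

Section Moebius.
Context {d : Order.disp_t} {T : finPOrderType d}.
Implicit Types x y z : T.

(* The fuel argument only serves termination, see [moebiusE]. *)
Fixpoint moebius_rec (k : nat) x y : int :=
  if k is k'.+1 then
    if x == y then 1
    else if (x < y)%O then - \sum_(z : T | (x <= z < y)%O) moebius_rec k' x z
    else 0
  else 0.

Definition moebius x y : int := moebius_rec #|T| x y.

Lemma moebius_rec_stable k l x y :
  (#|[pred z | (z < y)%O]| < k)%N -> (#|[pred z | (z < y)%O]| < l)%N ->
  moebius_rec k x y = moebius_rec l x y.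
Proof.
elim: k l y => [|k IHk] [|l] y //=; rewrite !ltnS => ltk ltl.
case: eqP => // _; case: ifP => // _; congr (- _).
apply: eq_bigr => z /andP[_ zy].
have lt_card : (#|[pred t | (t < z)%O]| < #|[pred t | (t < y)%O]|)%N.
  apply: proper_card; apply/properP; split.
    by apply/fintype.subsetP => t; rewrite !inE => /lt_trans; apply.
  by exists z; rewrite inE ?ltxx.
by apply: IHk; [exact: leq_trans lt_card ltk | exact: leq_trans lt_card ltl].
Qed.

Lemma moebiusE x y :
  moebius x y =
    if x == y then 1
    else if (x < y)%O then - \sum_(z : T | (x <= z < y)%O) moebius x z
    else 0.
Proof.
have lt_card z : (#|[pred t | (t < z)%O]| < #|T|)%N.
  apply: proper_card; apply/properP; split; first exact/fintype.subsetP.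
  by exists z; rewrite ?inE ?ltxx.
rewrite /moebius (@moebius_rec_stable _ #|T|.+1) ?lt_card //.
by apply: leq_trans (lt_card y) _.
Qed.

End Moebius.

(** * Formal series in noncommuting variables *)

Definition ncseries := seq nat -> rat^o.

(* The tensor product of two spaces of series is realised inside the          *)
(* functions of two words, [tens f g] being the pure tensor; [tens_free]      *)
(* below says that this realisation is faithful.                              *)
Definition ncseries2 := seq nat -> seq nat -> rat^o.

Definition tens (f g : ncseries) : ncseries2 := fun u v => f u * g v.

Notation "f ⊗ g" := (tens f g) (at level 40, left associativity) : ring_scope.

Lemma tens_free (m : nat) (f g : 'I_m -> ncseries) :
  (forall c : 'I_m -> rat, \sum_i c i *: g i = 0 -> forall i, c i = 0) ->
  \sum_i (f i ⊗ g i) = 0 -> forall i, f i = 0.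
Proof.
move=> free_g fg0 i; apply/funext => u.
apply: (free_g (fun i => f i u)); apply/funext => v.
have := congr1 (fun h : ncseries2 => h u v) fg0.
rewrite !fct_sumE /= => e.
by apply: etrans e; apply: eq_bigr.
Qed.

Local Open Scope classical_set_scope.

Definition linspan (V : lmodType rat) (S : set V) : set V :=
  [set v | exists (m : nat) (c : 'I_m -> rat) (s : 'I_m -> V),
     (forall i, S (s i)) /\ v = \sum_i c i *: s i].

Section LinSpan.
Variables (V : lmodType rat) (S : set V).

Lemma linspan_gen (x : V) : S x -> linspan S x.
Proof.
move=> Sx; exists 1%N, (fun=> 1), (fun=> x); split=> //.
by rewrite big_ord1 scale1r.
Qed.

Lemma linspan0 : linspan S 0.
Proof.
by exists 0%N, (fun=> 0), (fun=> 0); split; [case | rewrite big_ord0].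
Qed.

Lemma linspan_comb (a : rat) (x y : V) :
  linspan S x -> linspan S y -> linspan S (a *: x + y).
Proof.
move=> [m1 [c1 [s1 [S1 ->]]]] [m2 [c2 [s2 [S2 ->]]]].
exists (m1 + m2)%N.
exists (fun i =>
  match fintype.split i with inl j => a * c1 j | inr j => c2 j end).
exists (fun i => match fintype.split i with inl j => s1 j | inr j => s2 j end).
split; first by move=> i; case: fintype.split.
rewrite big_split_ord scaler_sumr; congr (_ + _); apply: eq_bigr => i _.
  by rewrite (unsplitK (inl i)) scalerA.
by rewrite (unsplitK (inr i)).
Qed.

Lemma linspan_sum (J : finType) (P : pred J) (F : J -> V) :
  (forall j, P j -> linspan S (F j)) -> linspan S (\sum_(j | P j) F j).
Proof.
move=> SF; elim/big_ind: _ => [|x y Sx Sy|//]; first exact: linspan0.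
by rewrite -[x]scale1r; exact: linspan_comb.
Qed.

End LinSpan.

Definition tens_space (A B : set ncseries) : set ncseries2 :=
  linspan [set f ⊗ g | f in A & g in B].

(** * NCQSym and its internal coproduct *)

Definition blk n (phi : setcomp n) (j : 'I_n) : nat :=
  find (fun B : {set 'I_n} => j \in B) phi.

Definition M_word n (phi : setcomp n) (w : seq nat) : bool :=
  [&& size w == n, all (leq 1) w
    & [forall j : 'I_n, forall k : 'I_n,
         ((nth 0 w j == nth 0 w k) == (blk phi j == blk phi k))
         && ((nth 0 w j < nth 0 w k) == (blk phi j < blk phi k))]]%N.

Definition M n (phi : setcomp n) : ncseries := fun w => (M_word phi w)%:R.

Definition NCQSym : set ncseries :=
  linspan [set f | exists (n : nat) (phi : setcomp n), f = M phi].

(* The word packed phi has letter k at the positions of the k-th block. By    *)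
(* [M_packed], f (packed phi) is the coefficient of M phi in f : NCQSym.      *)
Definition packed n (phi : setcomp n) : seq nat :=
  [seq (blk phi j).+1 | j <- enum 'I_n].

(* Linear extension of the values on the basis M, see [Delta_linear] and      *)
(* [Delta_M]; only set compositions of [size u] contribute to the value at    *)
(* (u, v).                                                                    *)
Definition Delta (f : ncseries) : ncseries2 := fun u v =>
  \sum_(phi : setcomp (size u)) f (packed phi) *
    \sum_(p : setcomp (size u) * setcomp (size u) | wedge p.1 p.2 == phi)
      (M p.1 ⊗ M p.2) u v.

Lemma size_packed n (phi : setcomp n) : size (packed phi) = n.
Proof. by rewrite size_map size_enum_ord. Qed.

Lemma nth_packed n (phi : setcomp n) (j : 'I_n) :
  nth 0%N (packed phi) j = (blk phi j).+1.
Proof. by rewrite (nth_map j) ?size_enum_ord // nth_ord_enum. Qed.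

Lemma blk_has n (phi : setcomp n) (j : 'I_n) :
  has (fun B : {set 'I_n} => j \in B) phi.
Proof.
case/and3P: (setcompP phi) => _ _ /eqP c; have: j \in [set: 'I_n]%SET.
  by rewrite inE.
rewrite -c; elim: (blocks phi) => [|B s IHs]; first by rewrite big_nil inE.
by rewrite big_cons inE /= => /orP[->//|/IHs ->]; rewrite orbT.
Qed.

Lemma blk_lt n (phi : setcomp n) (j : 'I_n) : (blk phi j < size phi)%N.
Proof. by rewrite /blk -has_find blk_has. Qed.

Lemma mem_blk n (phi : setcomp n) (j : 'I_n) (k : nat) :
  (j \in nth finset.set0 phi k) = (k == blk phi j).
Proof.
case/and3P: (setcompP phi) => _ ds _.
have jb := nth_find finset.set0 (blk_has phi j).
apply/idP/eqP => [jk|->//].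
have k_lt : (k < size phi)%N.
  by rewrite ltnNge; apply/negP => le; move: jk; rewrite nth_default // inE.
apply/eqP; rewrite -[_ == _]negbK neq_ltn; apply/negP => /orP[] lt.
- have /(pairwiseP finset.set0)/(_ _ _ _ _ lt) := ds.
  rewrite !inE blk_lt k_lt => /(_ isT isT) /pred0P/(_ j) /=.
  by rewrite jk jb.
- have /(pairwiseP finset.set0)/(_ _ _ _ _ lt) := ds.
  rewrite !inE blk_lt k_lt => /(_ isT isT) /pred0P/(_ j) /=.
  by rewrite jk jb.
Qed.

Lemma blk_onto n (phi : setcomp n) (k : nat) :
  (k < size phi)%N -> exists j, blk phi j = k.
Proof.
move=> lt; have /set0Pn[j] : nth finset.set0 phi k != finset.set0.
  apply: contraNneq (setcomp_set0 phi) => <-; exact: mem_nth.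
by rewrite mem_blk => /eqP ->; exists j.
Qed.

Lemma blk_inj n (phi psi : setcomp n) : blk phi =1 blk psi -> phi = psi.
Proof.
move=> e; apply: val_inj => /=.
have size_le (a b : setcomp n) : blk a =1 blk b -> (size a <= size b)%N.
  case: (posnP (size a)) => [->//|a0 eab].
  have lt : ((size a).-1 < size a)%N by rewrite prednK.
  have [j ej] := blk_onto lt.
  by rewrite -(prednK a0) -ej eab blk_lt.
have sz : size phi = size psi.
  by apply/eqP; rewrite eqn_leq !size_le // => j; rewrite e.
apply: (@eq_from_nth _ finset.set0) => // k _; apply/setP => j.
by rewrite !mem_blk e.
Qed.

Lemma M_packed n (phi psi : setcomp n) :
  M phi (packed psi) = (phi == psi)%:R.
Proof.
congr (_%:R); apply: congr1; apply/idP/eqP => [|<-]; last first.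
  rewrite /M_word size_packed eqxx /=; apply/andP; split.
    by apply/allP => _ /mapP[j _ ->].
  by apply/forallP => j; apply/forallP => k; rewrite !nth_packed eqSS !eqxx.
case/and3P=> _ _ /forallP H.
have cmp j k : ((blk psi j < blk psi k) = (blk phi j < blk phi k))%N.
  by move: (forallP (H j) k); rewrite !nth_packed => /andP[_ /eqP <-].
(* a surjection onto an initial segment is determined by the order it induces *)
have main (a b : setcomp n) :
    (forall j k, (blk a j < blk a k)%N -> (blk b j < blk b k)%N) ->
    forall j, (blk a j <= blk b j)%N.
  move=> ab j; move e : (blk a j) => m; elim: m j e => // m IHm j e.
  have [k ek] : exists k, blk a k = m.
    by apply: blk_onto; apply: leq_trans (blk_lt a j); rewrite e.
  by apply: leq_ltn_trans (IHm _ ek) _; apply: ab; rewrite ek e.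
apply: blk_inj => j; apply/eqP; rewrite eqn_leq.
by apply/andP; split; apply: main => ? ?; rewrite cmp.
Qed.

Lemma Delta_linear (a : rat) (f g : ncseries) :
  Delta (a *: f + g) = a *: Delta f + Delta g.
Proof.
apply/funext => u; apply/funext => v.
change (Delta (a *: f + g) u v = a * Delta f u v + Delta g u v).
rewrite /Delta big_distrr /= -big_split /=; apply: eq_bigr => phi _.
by rewrite mulrA -mulrDl.
Qed.

Lemma Delta_M n (phi : setcomp n) :
  Delta (M phi) =
    \sum_(p : setcomp n * setcomp n | wedge p.1 p.2 == phi) (M p.1 ⊗ M p.2).
Proof.
apply/funext => u; apply/funext => v; rewrite !fct_sumE /Delta.
have [e|ne] := eqVneq (size u) n.
  move: phi; rewrite -e => phi.
  rewrite (bigD1 phi) //= M_packed eqxx mul1r [X in _ + X]big1 ?addr0 // => psi ne.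
  by rewrite M_packed eq_sym (negbTE ne) mul0r.
rewrite big1 => [|psi _].
  rewrite big1 // => p _.
  by rewrite /tens /M /M_word (negbTE ne) /= mul0r.
by rewrite /M /M_word size_packed (negbTE ne) /= mul0r.
Qed.

Lemma Delta_NCQSym : Delta @` NCQSym `<=` tens_space NCQSym NCQSym.
Proof.
have Delta0 : Delta 0 = 0.
  by have := Delta_linear (- 1) 0 0; rewrite scaler0 addr0 scaleN1r addNr.
move=> _ [_ [m [c [s [sM ->]]]] <-].
have -> : Delta (\sum_i c i *: s i) = \sum_i c i *: Delta (s i).
  by elim/big_rec2: _ => // i y1 y2 _ <-; exact: Delta_linear.
apply: linspan_sum => i _; have [n [phi ->]] := sM i; rewrite Delta_M.
rewrite -[_ *: _]addr0; apply: linspan_comb; last exact: linspan0.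
apply: linspan_sum => p _; apply: linspan_gen.
exists (M p.1); first by apply: linspan_gen; exists n, p.1.
by exists (M p.2) => //; apply: linspan_gen; exists n, p.2.
Qed.

(** * The elements eta and the coefficients C *)

Definition pexp n (phi : oddcomp n) : nat := ((n - size phi)./2)%N.

Definition eta n (phi : oddcomp n) : ncseries :=
  (-1) ^+ pexp phi *:
    \sum_(psi : setcomp n | (psi <= oddcomp_val phi)%O) 2 ^+ size psi *: M psi.

(* Rearrangements xi of the blocks of phi with psi ∧ xi = phi. *)
Definition CC n (phi psi : setcomp n) : {set setcomp n} :=
  [set xi : setcomp n | perm_eq xi phi & wedge psi xi == phi]%SET.

Definition below_CC n (phi psi : setcomp n) (chi : setcomp n) : bool :=
  [exists xi in CC phi psi, (chi <= xi)%O].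

Definition Ccoef n (phi : oddcomp n) (psi : setcomp n) (chi : oddcomp n) : rat :=
  (-1) ^+ (pexp chi + pexp phi) *
    \sum_(zeta : oddcomp n | (chi <= zeta)%O && below_CC phi psi zeta)
      (moebius chi zeta)%:~R *
      2%:Q ^ ((size (wedge psi zeta))%:Z - (size zeta)%:Z).

(** * NCPi: enriched P-partitions *)

(* -1 < 1 < -2 < 2 < ... *)
Definition enriched_le (a b : int) : bool :=
  (`|a| < `|b|) || ((`|a| == `|b|) && (a <= b)).

(* The conditions bear on a < b in the poset: for a = b the conditions on     *)
(* gamma could never hold.                                                    *)
Definition enriched_partition d (P : finPOrderType d) n (gamma : P -> 'I_n)
    (f : {ffun P -> int}) : Prop :=
  (forall a, f a != 0) /\
  forall a b : P, (a < b)%O ->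
    [/\ enriched_le (f a) (f b),
        f a = f b -> 0 < f a -> (gamma a < gamma b)%N
      & f a = f b -> f a < 0 -> (gamma b < gamma a)%N].

(* w = |f(sigma^-1(1))| ... |f(sigma^-1(n))| *)
Definition reads d (P : finPOrderType d) n (sigma : P -> 'I_n)
    (f : {ffun P -> int}) (w : seq nat) : Prop :=
  size w = n /\ forall a : P, nth 0%N w (sigma a) = `|f a|%N.

(* For bijective sigma, each word is read by at most 2 ^ n functions f, so    *)
(* the sum has finite support.                                                *)
Definition K d (P : finPOrderType d) n (gamma sigma : P -> 'I_n) : ncseries :=
  fun w =>
    \sum_(f \in [set f : {ffun P -> int} |
                 enriched_partition gamma f /\ reads sigma f w]) (1 : rat).

Definition NCPi : set ncseries :=
  linspan [set g | exists (n : nat) (d : Order.disp_t) (P : finPOrderType d)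
                     (gamma sigma : P -> 'I_n),
     [/\ bijective gamma, bijective sigma & g = K gamma sigma]].

(* Main.v *)
(* Call a function [a] on set compositions cancelling when the series with     *)
(* coefficients [a] on the [M phi] loses its dependence on [t] once [t] and    *)
(* [- t] are substituted for two adjacent variables.  The relation attached to *)
(* a block of even size expresses the value at [phi] through values at finer   *)
(* set compositions, so a cancelling function is determined by its values at   *)
(* the odd ones.  The series [K] are cancelling, by a sign-reversing           *)
(* involution, and [eta phi] is an alternating sum of series [K] over the      *)
(* labellings of a chain, hence cancelling; so cancelling functions, [NCPi]    *)
(* and the span of the [eta phi] coincide, with coefficients given by Moebius  *)
(* inversion on the odd set compositions.  Finally [a (psi ∧ _)] is cancelling *)
(* when [a] is, and [psi ∧ zeta <= phi] holds exactly when [zeta] is below     *)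
(* some element of [CC phi psi].                                               *)

From mathcomp Require Import all_classical.
From mathcomp Require Import all_boot all_order all_algebra.
From mathcomp Require Import zify ring lra.
Require Import Defs.

Set Implicit Arguments.
Unset Strict Implicit.
Unset Printing Implicit Defensive.

Import Order.TTheory GRing.Theory Num.Theory.

(** * The order on set compositions *)

(** Let [mseries a] be the series with coefficient [a phi] on [M phi]. The coproduct turns [a] into
    the functions [a (wedge psi _)], one for each left factor [M psi] ([Delta_mseries]), so the
    co-ideal property asks for a linear condition on [a] that is stable under these operators and
    characterises the elements of [NCPi].

    That condition is [cancelling]. The series [K] satisfy it ([Kcoef_cancelling]), hence so does
    [eta phi] for odd [phi], a signed combination of series [K] of chains ([ecoef_Kcoef]). It is
    stable because each relation for [a (wedge psi _)] is a signed sum of relations for [a]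
    ([cancelling_wedge]).

    A cancelling function is determined by its values at odd set compositions ([cancelling_eq0]).
    There, expanding in the [eta chi] is a triangular system that Moebius inversion solves
    ([cancelling_ecoef]). For the functions obtained from [eta phi], the solution is [Ccoef]
    ([eta_coef_wedge]), the support being identified by [below_CCE]. *)

Lemma find_filter_lt (T : Type) (p q r : pred T) (s : seq T) :
  (forall x, p x -> r x) -> (forall x, q x -> r x) ->
  (find p (filter r s) < find q (filter r s)) = (find p s < find q s).
Proof.
move=> pr qr; elim: s => //= x s IHs; case: ifP => rx /=.
  by case: ifP => // _; case: ifP => // _; rewrite !ltnS.
by rewrite !ifN ?ltnS //; [apply: contraFN rx => /qr | apply: contraFN rx => /pr].
Qed.

Section Blocks.
Variable n : nat.
Implicit Types (phi psi chi xi zeta : setcomp n) (u v : 'I_n -> nat) (j k : 'I_n).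

Lemma find_allpairs_setI (s t : seq {set 'I_n}) j :
  has (fun B : {set 'I_n} => j \in B) s -> has (fun B : {set 'I_n} => j \in B) t ->
  find (fun B : {set 'I_n} => j \in B) [seq A :&: B | A <- s, B <- t] =
    find (fun B : {set 'I_n} => j \in B) s * size t
      + find (fun B : {set 'I_n} => j \in B) t.
Proof.
move=> hs ht; elim: s hs => //= A s IHs; rewrite find_cat size_map has_map find_map.
case: (boolP (j \in A)) => jA /= hs.
  have e : preim (fun B => A :&: B) (fun B : {set 'I_n} => j \in B)
      =1 (fun B : {set 'I_n} => j \in B) by move=> B /=; rewrite inE jA.
  by rewrite (eq_has e) (eq_find e) ht.
have e : preim (fun B => A :&: B) (fun B : {set 'I_n} => j \in B) =1 pred0.
  by move=> B /=; rewrite inE (negbTE jA).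
by rewrite (eq_has e) has_pred0 (IHs hs) mulSn addnA.
Qed.

Lemma blk_wedge_lt psi chi j k :
  (blk (wedge psi chi) j < blk (wedge psi chi) k) =
    (blk psi j * size chi + blk chi j < blk psi k * size chi + blk chi k).
Proof.
(* Deleting the empty intersections does not change which of two positions comes first. *)
rewrite {1 2}/blk /= /wedge_seq find_filter_lt; last 2 first.
- by move=> B jB; apply/set0Pn; exists j.
- by move=> B jB; apply/set0Pn; exists k.
by rewrite !find_allpairs_setI ?blk_has.
Qed.

Lemma ltn_lex (N a b c d : nat) : c < N -> d < N ->
  (a * N + c < b * N + d) = (a < b) || (a == b) && (c < d).
Proof.
move=> cN dN; case: (ltngtP a b) => [ab|ba|->] /=; last by rewrite ltn_add2l.
  have: a.+1 * N <= b * N by rewrite leq_mul2r ab orbT.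
  lia.
have: b.+1 * N <= a * N by rewrite leq_mul2r ba orbT.
lia.
Qed.

Lemma flatten_filter_sorted (T : eqType) (h : T -> nat) (s : seq T) m :
  sorted (relpre h leq) s ->
  flatten [seq [seq x <- s | h x == i] | i <- iota 0 m] = [seq x <- s | h x < m].
Proof.
have tr : transitive (relpre h leq) by move=> y x z; apply: leq_trans.
rewrite (sorted_pairwise tr) => srt.
elim: m => [|m IHm]; first by rewrite /= (@eq_filter _ _ pred0) ?filter_pred0.
rewrite -addn1 iotaD map_cat flatten_cat {}IHm /= cats0 add0n addn1.
elim: s srt => //= x s IHs /andP[/allP hx /IHs <-]; rewrite ltnS [h x <= m]leq_eqVlt.
case: (ltngtP (h x) m) => //= hxm.
have e : {in s, (fun y => h y < m) =1 pred0}.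
  by move=> y /hx /= le; apply/negbTE; rewrite -leqNgt -hxm.
by rewrite (eq_in_filter e) filter_pred0.
Qed.

Lemma join_blocksE (s : seq {set 'I_n}) j :
  (j \in join_blocks s) = has (fun B : {set 'I_n} => j \in B) s.
Proof.
rewrite /join_blocks; elim: s => [|B s IHs]; first by rewrite big_nil inE.
by rewrite big_cons inE /= IHs.
Qed.

Lemma coarser_blk (ss : seq (seq {set 'I_n})) j k :
  let p (j : 'I_n) (B : {set 'I_n}) := j \in B in
  has (p j) (flatten ss) -> has (p k) (flatten ss) ->
  find (p j) (flatten ss) <= find (p k) (flatten ss) ->
  find (p j) [seq join_blocks s | s <- ss] <= find (p k) [seq join_blocks s | s <- ss].
Proof.
move=> p; elim: ss => //= s ss IHss; rewrite !has_cat !find_cat /p !join_blocksE -!/(p _).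
case: ifP => //= hj; case: ifP => //= hk hjs hks; last first.
  by rewrite leq_add2l ltnS; apply: IHss.
rewrite leqNgt => /negP[]; apply: leq_trans (_ : size s <= _); last exact: leq_addr.
by rewrite -has_find.
Qed.

(** For the converse, [h] sends a block of [phi] to the index of the block of [psi] containing it.
    It increases weakly along [phi], so its fibres are the consecutive segments to be merged. *)
Lemma setcomp_leP psi phi :
  reflect (forall j k, blk phi j <= blk phi k -> blk psi j <= blk psi k)
    (psi <= phi)%O.
Proof.
apply: (iffP idP) => [/asboolP[ss [fss jss]] j k|H].
  rewrite /blk -jss -fss; apply: coarser_blk; rewrite fss; exact: blk_has.
pose h (B : {set 'I_n}) := find (fun A : {set 'I_n} => B \subset A) psi.
have hE l : l < size phi -> exists2 j, blk phi j = l & h (nth set0 phi l) = blk psi j.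
  move=> /blk_onto[j jl]; exists j => //.
  apply: eq_in_find => A /(nthP set0)[i _ <-]; rewrite -jl.
  apply/subsetP/idP => [|ji k]; first by apply; rewrite mem_blk.
  rewrite mem_blk => /eqP jk; move: ji; rewrite !mem_blk => /eqP ->.
  by rewrite eqn_leq !H ?jk.
have srt : sorted (relpre h leq) phi.
  apply/(sortedP set0) => i lt /=.
  have [j ji ->] := hE i (ltnW lt); have [k ki ->] := hE _ lt.
  by apply: H; rewrite ji ki.
have h_lt : {in blocks phi, forall B, h B < size psi}.
  by move=> B /(nthP set0)[i /hE[j _ e] <-]; rewrite e blk_lt.
apply/asboolP; exists [seq [seq B <- phi | h B == i] | i <- iota 0 (size psi)]; split.
  by rewrite flatten_filter_sorted // (@eq_in_filter _ _ predT) ?filter_predT // => B /h_lt ->.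
apply: (@eq_from_nth _ set0); rewrite !size_map size_iota // => i lt.
rewrite (nth_map [::]) ?size_map ?size_iota // (nth_map 0) ?size_iota // nth_iota //.
apply/setP => j; rewrite join_blocksE mem_blk add0n.
have jB : j \in nth set0 phi (blk phi j) by rewrite mem_blk.
have [j' ej' hj] := hE _ (blk_lt phi j).
have jj' : blk psi j' = blk psi j by apply/eqP; rewrite eqn_leq !H ?ej'.
apply/hasP/eqP => [[B]|->].
  rewrite mem_filter => /andP[/eqP <- /(nthP set0)[l _ <-]].
  by rewrite mem_blk => /eqP ->; rewrite hj jj'.
by exists (nth set0 phi (blk phi j)); rewrite // mem_filter mem_nth ?blk_lt // hj jj' eqxx.
Qed.

Lemma blk_le_wedge psi chi j k :
  (blk (wedge psi chi) j <= blk (wedge psi chi) k) =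
    (blk psi j < blk psi k) || (blk psi j == blk psi k) && (blk chi j <= blk chi k).
Proof.
rewrite leqNgt blk_wedge_lt ltn_lex ?blk_lt // negb_or negb_and -!leqNgt.
by case: (ltngtP (blk psi j) (blk psi k)).
Qed.

(** * Packing words into set compositions *)

Definition fibers u : seq {set 'I_n} :=
  [seq [set j | u j == m] | m <- iota 0 (\max_j u j).+1].

Lemma pack_subproof u : is_setcomp [seq A <- fibers u | A != set0].
Proof.
apply/and3P; split; first by rewrite mem_filter eqxx.
  apply: pairwise_filter; rewrite pairwise_map.
  have : pairwise (fun a b : nat => a != b) (iota 0 (\max_j u j).+1).
    by rewrite -uniq_pairwise iota_uniq.
  apply: sub_pairwise => a b ab /=; apply/pred0P => j /=; rewrite !inE.
  by apply/negP => /andP[/eqP -> /eqP ba]; rewrite ba eqxx in ab.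
apply/eqP/setP => j; rewrite inE -[LHS]/(j \in join_blocks _) join_blocksE.
apply/hasP; exists [set k | u k == u j]; rewrite ?inE //.
rewrite mem_filter map_f ?andbT; last by rewrite mem_iota ltnS leq_bigmax.
by apply/set0Pn; exists j; rewrite inE.
Qed.

(** Only the relative order of the letters matters ([eq_pack]), so set compositions can be handled
    as words in any convenient encoding of the letters. *)
Definition pack u : setcomp n := SetComp (pack_subproof u).

Lemma blk_pack_lt u j k : (blk (pack u) j < blk (pack u) k) = (u j < u k).
Proof.
rewrite /blk find_filter_lt; last 2 first.
- by move=> B jB; apply/set0Pn; exists j.
- by move=> B jB; apply/set0Pn; exists k.
have e i : find (fun B : {set 'I_n} => i \in B) (fibers u) = u i.
  rewrite find_map (@eq_find _ _ (pred1 (u i))) => [|m /=]; last by rewrite inE eq_sym.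
  rewrite -/(index (u i) _) -[X in index X _]add0n -{1}(@nth_iota 0 0 (\max_j u j).+1 (u i)).
    by rewrite index_uniq ?iota_uniq // size_iota ltnS leq_bigmax.
  by rewrite ltnS leq_bigmax.
by rewrite !e.
Qed.

Lemma blk_pack_le u j k : (blk (pack u) j <= blk (pack u) k) = (u j <= u k).
Proof. by rewrite leqNgt blk_pack_lt -leqNgt. Qed.

Lemma blk_pack_eq u j k : (blk (pack u) j == blk (pack u) k) = (u j == u k).
Proof. by rewrite eqn_leq !blk_pack_le -eqn_leq. Qed.

Lemma setcomp_eqP phi psi :
  (forall j k, (blk phi j <= blk phi k) = (blk psi j <= blk psi k)) -> phi = psi.
Proof.
by move=> H; apply/le_anti/andP; split; apply/setcomp_leP => j k; rewrite H.
Qed.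

Lemma eq_pack u v : (forall j k, (u j <= u k) = (v j <= v k)) -> pack u = pack v.
Proof. by move=> H; apply: setcomp_eqP => j k; rewrite !blk_pack_le. Qed.

Lemma pack_blk phi : pack (blk phi) = phi.
Proof. by apply: setcomp_eqP => j k; rewrite blk_pack_le. Qed.

Lemma le_wedgel psi chi : (psi <= wedge psi chi)%O.
Proof. by apply/setcomp_leP => j k; rewrite blk_le_wedge; case: ltngtP. Qed.

(* The rearrangement of [phi] realising the membership is [zeta ∧ phi]. *)
Lemma below_CCE phi psi zeta : below_CC phi psi zeta = (wedge psi zeta <= phi)%O.
Proof.
apply/existsP/idP => [[xi /andP[]]|H].
  rewrite inE => /andP[_ /eqP <-] /setcomp_leP zx; apply/setcomp_leP => j k.
  rewrite !blk_le_wedge => /orP[->//|/andP[/eqP -> /zx ->]].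
  by rewrite eqxx orbT.
have {}H j k : blk phi j <= blk phi k ->
    (blk psi j < blk psi k) || (blk psi j == blk psi k) && (blk zeta j <= blk zeta k).
  by rewrite -blk_le_wedge; apply/setcomp_leP.
have ceq j k : blk phi j = blk phi k -> blk zeta j = blk zeta k.
  move=> e; have := H j k; have := H k j; rewrite e leqnn => /(_ isT) h1 /(_ isT) h2.
  lia.
exists (wedge zeta phi); rewrite inE; apply/andP; split; last exact: le_wedgel.
apply/andP; split; last first.
  apply/eqP/setcomp_eqP => j k; rewrite !blk_le_wedge.
  have := H j k; have := H k j; have := ceq j k; lia.
have uniq_blocks xi : uniq (blocks xi).
  have /and3P[x0 xd _] := setcompP xi; rewrite uniq_pairwise.
  apply/(pairwiseP set0) => i l il ll ltl.
  have := pairwiseP set0 xd i l il ll ltl; rewrite -setI_eq0; apply: contraTneq => ->.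
  by rewrite setIid; apply: contraNneq x0 => <-; apply: mem_nth.
have mem_blocks xi (B : {set 'I_n}) :
    reflect (exists j, B = [set k | blk xi k == blk xi j]) (B \in blocks xi).
  have e j : nth set0 xi (blk xi j) = [set k | blk xi k == blk xi j].
    by apply/setP => k; rewrite mem_blk inE eq_sym.
  apply: (iffP (nthP set0)) => [[i /blk_onto[j <-] <-]|[j ->]]; first by exists j.
  by exists (blk xi j); rewrite ?blk_lt.
apply: uniq_perm => // B; apply/mem_blocks/mem_blocks => -[j ->]; exists j;
  apply/setP => k; rewrite !inE [in RHS]eqn_leq [in LHS]eqn_leq !blk_le_wedge;
  have := ceq j k; have := ceq k j; lia.
Qed.

End Blocks.

(** * The cancellation property of enriched P-partitions *)

Lemma sum_involution (T : finType) (P : pred T) (h : T -> T) (F : T -> rat) :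
  (forall x, P x -> P (h x)) -> (forall x, P x -> h (h x) = x) ->
  (forall x, P x -> F (h x) = - F x)%R -> (\sum_(x | P x) F x = 0)%R.
Proof.
move=> Ph hK Fh; have : (\sum_(x | P x) F x = - \sum_(x | P x) F x)%R; last by lra.
rewrite -sumrN [LHS](reindex_onto h h) /=; last by move=> x /hK.
apply: eq_big => [x|x /andP[/Ph Px /eqP hx]]; last by rewrite Fh // -hx.
by apply/andP/idP => [[/Ph Phx /eqP <-//]|Px]; rewrite hK ?eqxx ?Ph.
Qed.

Section Toggle.
Variable I : finType.
Implicit Types (x : I) (C : {set I}).

Definition toggle x C : {set I} := [set j | (j == x) (+) (j \in C)].

Lemma toggleK x : involutive (toggle x).
Proof. by move=> C; apply/setP => j; rewrite !inE addbA addbb. Qed.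

Lemma sign_toggle x C : ((-1) ^+ #|toggle x C| = - (-1) ^+ #|C| :> rat)%R.
Proof.
have e : toggle x C :\ x = C :\ x by apply/setP => j; rewrite !inE; case: eqVneq.
rewrite (cardsD1 x) (cardsD1 x C) e inE eqxx; case: (x \in C) => /=.
  by rewrite add0n add1n exprS mulN1r opprK.
by rewrite add0n add1n exprS mulN1r.
Qed.

End Toggle.

Section Cancellation.
Variable n : nat.
Implicit Types (u v : 'I_n -> nat) (j k x : 'I_n) (C E : {set 'I_n}).
Implicit Types (R : rel 'I_n) (g : 'I_n -> nat) (a : setcomp n -> rat).

Definition split_word u C j := (u j).*2 + (j \in C).

(* The letters [2 m] and [2 m + 1] are the variables replaced by [t], [- t].  *)
Definition cancelling a := forall u m, (exists j, u j = m) ->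
  (\sum_(C : {set 'I_n} | C \subset [set j | u j == m])
     (-1) ^+ #|C| * a (pack (split_word u C)) = 0)%R.

(* The letters [-i] and [i] are encoded as [2 i] and [2 i + 1].               *)
Definition admissible R g v : bool :=
  [forall j, forall k, R j k ==>
    (v j < v k) || (v j == v k) && (if odd (v j) then g j < g k else g k < g j)].

Definition Kcoef R g u : rat := \sum_(E : {set 'I_n}) (admissible R g (split_word u E))%:R.

Lemma eq_admissible R g v v' :
  (forall j k, (v j < v k) = (v' j < v' k)) -> (forall j, odd (v j) = odd (v' j)) ->
  admissible R g v = admissible R g v'.
Proof.
move=> lt_v odd_v; apply: eq_forallb => j; apply: eq_forallb => k.
have eqE w : (w j == w k) = ~~ (w j < w k) && ~~ (w k < w j) by case: ltngtP.
by rewrite odd_v !eqE !lt_v.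
Qed.

Lemma eq_Kcoef R R' g g' u : R =2 R' -> (forall j k, (g j < g k) = (g' j < g' k)) ->
  Kcoef R g u = Kcoef R' g' u.
Proof.
move=> eR eg; apply: eq_bigr => E _; congr (_%:R)%R; congr nat_of_bool.
by apply: eq_forallb => j; apply: eq_forallb => k; rewrite eR !eg.
Qed.

Lemma split_word_lt u E j k :
  (split_word u E j < split_word u E k) =
    (u j < u k) || (u j == u k) && ((j \in E) < (k \in E)).
Proof. by rewrite /split_word; case: (j \in E); case: (k \in E); lia. Qed.

Lemma odd_split_word u E j : odd (split_word u E j) = (j \in E).
Proof. by rewrite oddD odd_double oddb. Qed.

Lemma Kcoef_pack R g u : Kcoef R g (blk (pack u)) = Kcoef R g u.
Proof.
apply: eq_bigr => E _; congr (_%:R)%R; congr nat_of_bool.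
apply: eq_admissible => j *; last by rewrite !odd_split_word.
by rewrite !split_word_lt blk_pack_lt blk_pack_eq.
Qed.

(** Here [x] moves within the pair [4m+1, 4m+2], having the largest label there, or within the pair
    [4m, 4m+3], having the smallest label there while nothing lies strictly between. The rule for
    ties at odd and even values then asks the same thing of both positions of [x]: elements related
    to [x] lie below it if they have the lower value of the pair, and above it if they have the
    upper one. *)
Lemma admissible_toggle R g (m : nat) x v v' :
  (forall j, j != x -> v' j = v j) -> v' x + v x = 8 * m + 3 ->
  (v x = 4 * m + 1 \/ v x = 4 * m + 2) /\
    (forall j, j != x -> v j = 4 * m + 1 \/ v j = 4 * m + 2 -> g j < g x) \/
  (v x = 4 * m \/ v x = 4 * m + 3) /\
    (forall j, j != x -> v j <> 4 * m + 1 /\ v j <> 4 * m + 2) /\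
    (forall j, j != x -> v j = 4 * m \/ v j = 4 * m + 3 -> g x < g j) ->
  admissible R g v -> admissible R g v'.
Proof.
move=> v'E v'x H /forallP adm; apply/forallP => j; apply/forallP => k.
apply/implyP => Rjk; move: (implyP (forallP (adm j) k) Rjk).
have odd4 c : odd (4 * m + c) = odd c by rewrite oddD oddM.
have odd_eq w i : (w j == w i) && (if odd (w j) then g j < g k else g k < g j) =
    (w j == w i) && (if odd (w i) then g j < g k else g k < g j).
  by case: eqVneq => // ->.
have vx_cases : exists2 c, v x = 4 * m + c & v' x = 4 * m + (3 - c) /\ c < 4.
  exists (v x - 4 * m); lia.
case: vx_cases => c vx [v'x' c4].
have Hx i : i != x ->
    (c = 1 \/ c = 2) /\ (v i = 4 * m + 1 \/ v i = 4 * m + 2 -> g i < g x) \/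
    (c = 0 \/ c = 3) /\ (v i <> 4 * m + 1 /\ v i <> 4 * m + 2) /\
      (v i = 4 * m \/ v i = 4 * m + 3 -> g x < g i).
  by move=> ix; case: H => [[vx' /(_ i ix)]|[vx' [/(_ i ix) ? /(_ i ix)]]]; lia.
have [jx|jx] := eqVneq j x; have [kx|kx] := eqVneq k x.
- by rewrite jx kx !ltnn !eqxx /= !if_same.
- rewrite jx (v'E k kx) vx v'x' !odd4; have := Hx k kx.
  by case: c c4 {vx v'x' Hx} => [|[|[|[|//]]]] _ /=; lia.
- rewrite !odd_eq kx (v'E j jx) vx v'x' !odd4; have := Hx j jx.
  by case: c c4 {vx v'x' Hx} => [|[|[|[|//]]]] _ /=; lia.
- by rewrite !v'E.
Qed.

(* With [D] the symmetric difference of [C] and [E], the value [4 i + 2 [j ∈  *)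
(* C] + [j ∈ E]] at [j ∈ B] is [4 i + 1] or [4 i + 2] for [j ∈ D], and [4 i]  *)
(* or [4 i + 3] otherwise; moving one suitably extremal [x] within its pair   *)
(* preserves admissibility.                                                   *)
Lemma Kcoef_cancelling R g : injective g -> cancelling (fun phi => Kcoef R g (blk phi)).
Proof.
move=> g_inj u m [j0 j0m]; set B := [set j | u j == m].
have j0B : j0 \in B by rewrite inE j0m.
pose S (p : {set 'I_n} * {set 'I_n}) := [set j in B | (j \in p.1) (+) (j \in p.2)].
pose piv (T : {set 'I_n}) := if [pick y in T] is Some y0
  then [arg max_(y > y0 in T) g y] else [arg min_(y < j0 in B) g y].
(* The pivot depends on [p] only through [S p], which [h] preserves; hence [h] is an involution. *)
pose h p := (toggle (piv (S p)) p.1, toggle (piv (S p)) p.2).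
have Sh p : S (h p) = S p.
  by apply/setP => j; rewrite !inE /=; case: (j == _); case: (j \in p.1); case: (j \in p.2).
have pivP p : let x := piv (S p) in x \in B /\
    ((x \in S p) /\ (forall j, j \in S p -> j != x -> g j < g x) \/
     (S p = set0) /\ (forall j, j \in B -> j != x -> g x < g j)).
  rewrite /piv; case: pickP => [y0 y0S|S0] /=.
    case: arg_maxnP => // x xS x_max; split; first by case/setIdP: xS.
    left; split=> // j jS jx; have le : g j <= g x := x_max j jS.
    rewrite ltn_neqAle le andbT.
    by apply: contraNneq jx => /g_inj ->.
  case: arg_minnP => // x xB x_min; split=> //; right; split.
    by apply/setP => j; rewrite S0 inE.
  move=> j jB jx; have le : g x <= g j := x_min j jB.
  rewrite ltn_neqAle le andbT.
  by apply: contraNneq jx => /g_inj ->.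
under eq_bigr do rewrite Kcoef_pack /Kcoef mulr_sumr.
rewrite pair_big_dep /=.
apply: (sum_involution (h := h)) => [[C E] /=|p _|[C E] /= CB].
- rewrite andbT => /subsetP CB.
  have [xB _] := pivP (C, E); rewrite andbT; apply/subsetP => j; rewrite inE.
  by have [->//|_ /CB] := eqVneq j (piv (S (C, E))).
- by rewrite {1}/h Sh /h /= !toggleK; case: p.
rewrite sign_toggle mulNr; congr (- (_ * _%:R))%R; congr nat_of_bool.
set x := piv _; have := pivP (C, E); rewrite -/x => -[xB xS].
have mod4 C' E' j : split_word (split_word u C') E' j =
    4 * u j + (2 * (j \in C') + (j \in E')).
  by rewrite /split_word; lia.
have imp C' E' : S (C', E') = S (C, E) ->
    admissible R g (split_word (split_word u C') E') ->
    admissible R g (split_word (split_word u (toggle x C')) (toggle x E')).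
  move=> eS; apply: (@admissible_toggle R g m x).
  - by move=> j jx; rewrite !mod4 !inE (negbTE jx).
  - rewrite !mod4 !inE eqxx; move: xB; rewrite inE => /eqP ->.
    by case: (x \in C'); case: (x \in E'); lia.
  - have inS j : (j \in S (C, E)) = (u j == m) && ((j \in C') (+) (j \in E')).
      by rewrite -eS !inE.
    case: xS => [[xS gx]|[S0 gx]]; [left|right].
      split; first (move: xS; rewrite inS mod4; case: (_ \in C'); case: (_ \in E') => /=; lia).
      move=> j jx vj; apply: gx => //; move: vj; rewrite inS mod4.
      by case: (_ \in C'); case: (_ \in E') => /=; lia.
    have {}inS j : (u j == m) && ((j \in C') (+) (j \in E')) = false.
      by rewrite -inS S0 inE.
    split; last split.
    + by have := inS x; move: xB; rewrite inE mod4; case: (_ \in C'); case: (_ \in E') => /=; lia.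
    + by move=> j _; have := inS j; rewrite mod4; case: (_ \in C'); case: (_ \in E') => /=; lia.
    + move=> j jx vj; apply: gx => //; move: vj; rewrite inE mod4.
      by case: (_ \in C'); case: (_ \in E') => /=; lia.
apply/idP/idP => [|/imp]; last exact.
have /imp : S (h (C, E)) = S (C, E) by [].
by rewrite /h -/x /= !toggleK.
Qed.

End Cancellation.

(** * Cancelling functions *)

Section CancellingSpace.
Variable n : nat.
Implicit Types (u v : 'I_n -> nat) (j k : 'I_n) (C : {set 'I_n}) (a : setcomp n -> rat).
Implicit Types (phi psi chi zeta : setcomp n).

Lemma eq_cancelling a b : a =1 b -> cancelling a -> cancelling b.
Proof. by move=> /funext ->. Qed.

Lemma cancelling_sum (T : finType) (c : T -> rat) (b : T -> setcomp n -> rat) :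
  (forall i, cancelling (b i)) -> cancelling (fun phi => \sum_i c i * b i phi)%R.
Proof.
move=> H u m hm; under eq_bigr do rewrite mulr_sumr.
rewrite exchange_big big1 // => i _; under eq_bigr do rewrite mulrCA.
by rewrite -mulr_sumr H ?mulr0.
Qed.

Lemma cancellingZ (c : rat) a : cancelling a -> cancelling (fun phi => c * a phi)%R.
Proof.
by move=> ca u m /ca e; under eq_bigr do rewrite mulrCA; rewrite -mulr_sumr e mulr0.
Qed.

Lemma odd_blocksPn phi : ~~ odd_blocks phi ->
  exists j, ~~ odd #|[set k | blk phi k == blk phi j]|.
Proof.
move=> /allPn[_ /(nthP set0)[i /blk_onto[j <-] <-] ev]; exists j.
rewrite (_ : [set _ | _] = nth set0 phi (blk phi j)) //.
by apply/setP => k; rewrite mem_blk inE eq_sym.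
Qed.

(* For a block [B] of even size, the relation reads 2 a(phi) = combination of *)
(* values of [a] at strictly finer set compositions.                          *)
Lemma cancelling_eq0 a : cancelling a ->
  (forall phi, odd_blocks phi -> a phi = 0%R) -> forall phi, a phi = 0%R.
Proof.
move=> ca a0 phi; have [m] := ubnP #|[pred z | (phi < z)%O]|.
elim: m phi => // m IHm phi; rewrite ltnS => lem.
case: (boolP (odd_blocks phi)) => [/a0 //|/odd_blocksPn[j evB]].
set B := [set k | blk phi k == blk phi j] in evB.
have := ca (blk phi) (blk phi j) (ex_intro _ j erefl); rewrite -/B.
have jB : j \in B by rewrite inE.
rewrite (bigD1 B) //= (bigD1 set0) /=; last first.
  by rewrite sub0set eq_sym; apply/set0Pn; exists j.
have e0 : pack (split_word (blk phi) set0) = phi.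
  by apply: setcomp_eqP => k l; rewrite blk_pack_le /split_word !inE leqNgt; lia.
have eB : pack (split_word (blk phi) B) = phi.
  apply: setcomp_eqP => k l; rewrite blk_pack_le /split_word !inE.
  by case: eqP; case: eqP; lia.
rewrite e0 eB cards0 -signr_odd (negbTE evB) expr0 !mul1r big1 ?addr0; first lra.
move=> C /andP[/andP[/subsetP CB CnB] C0]; rewrite IHm ?mulr0 //.
apply: leq_trans lem; apply/proper_card/properP.
have lt : (phi < pack (split_word (blk phi) C))%O.
  have /set0Pn[k kC] := C0.
  have /subsetPn[l lB lC] : ~~ (B \subset C).
    by apply: contra CnB => BC; rewrite eqEsubset BC andbT; apply/subsetP.
  rewrite lt_def; apply/andP; split.
    apply: contraNneq lC => e; have := blk_pack_le (split_word (blk phi) C) k l.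
    rewrite e /split_word kC; have := CB k kC; move: lB; rewrite !inE => /eqP -> /eqP ->.
    by case: (l \in C); lia.
  apply/setcomp_leP => k' l'; rewrite blk_pack_le /split_word.
  by case: (_ \in C); case: (_ \in C); lia.
split; first by apply/subsetP => z; rewrite !inE; apply: lt_trans.
by exists (pack (split_word (blk phi) C)); rewrite ?inE ?ltxx.
Qed.

Lemma wedge_pack psi u (N : nat) : (forall j, u j < N) ->
  wedge psi (pack u) = pack (fun j => blk psi j * N + u j).
Proof.
move=> uN; apply: setcomp_eqP => j k; rewrite blk_le_wedge !blk_pack_le.
rewrite [RHS]leqNgt ltn_lex // negb_or negb_and -!leqNgt.
by case: (ltngtP (blk psi j) (blk psi k)).
Qed.

(* The fibre [B] of [u] splits into fibres of [psi ∧ u]; cancel along one of  *)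
(* them, [B'].                                                                *)
Lemma cancelling_wedge psi a : cancelling a -> cancelling (fun phi => a (wedge psi phi)).
Proof.
move=> ca u m [j0 j0m]; set B := [set j | u j == m].
pose N := (\max_j u j).+1; have uN j : u j < N by rewrite ltnS leq_bigmax.
(* [w j] encodes the pair [(blk psi j, u j)] in base [N]; doubling the base to [N.*2] leaves room
   for the split letters. *)
pose w j := blk psi j * N + u j.
have packE C : wedge psi (pack (split_word u C)) = pack (split_word w C).
  rewrite (@wedge_pack _ _ N.*2); last first.
    by move=> j; have := uN j; rewrite /split_word; case: (_ \in _); lia.
  by congr pack; apply/funext => j; rewrite /split_word /w -addnn; nia.
under eq_bigr do rewrite packE.
pose B' := [set j | w j == w j0].
have w_eq j k : w j = w k -> u j = u k.
  by have := ltn_lex (blk psi j) (blk psi k) (uN j) (uN k);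
     have := ltn_lex (blk psi k) (blk psi j) (uN k) (uN j); rewrite -!/(w _); lia.
have B'B : B' \subset B.
  by apply/subsetP => j; rewrite !inE => /eqP/w_eq ->; rewrite j0m.
rewrite (partition_big (fun C => C :\: B')
  (fun D : {set 'I_n} => [disjoint D & B'] && (D \subset B))) /=; last first.
  move=> C CB; rewrite -setI_eq0 setDE -setIA [~: _ :&: _]setIC setICr setI0 eqxx.
  by rewrite -setDE (subset_trans (subsetDl _ _)).
rewrite big1 // => D /andP[dDB DB].
(* [D], the part of the split outside [B'], is kept fixed. In [split_word w D] the doubled letter of
   [j0] occurs exactly on [B'], so the inner sum is one relation for [a], up to the sign of [D]. *)
have := ca (split_word w D) (w j0).*2; rewrite /=.
have -> : [set j | split_word w D j == (w j0).*2] = B'.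
  apply/setP => j; rewrite !inE /split_word; case: (boolP (j \in D)) => jD; last by lia.
  by have := disjointFr dDB jD; rewrite inE; lia.
move=> /(_ (ex_intro _ j0 _)) H.
rewrite (reindex_onto (fun C => C :|: D) (fun C => C :&: B')) /=; last first.
  by move=> C /andP[_ /eqP <-]; rewrite setID.
have DIB' : D :&: B' = set0 by apply/eqP; rewrite setI_eq0.
transitivity ((-1) ^+ #|D| * 0 : rat)%R; last by rewrite mulr0.
rewrite -[X in _ = (_ * X)%R]H; last first.
  by rewrite /split_word (disjointFl dDB) ?addn0 ?inE.
rewrite mulr_sumr; apply: eq_big => [C|C].
  rewrite subUset DB andbT setDUl setIUl DIB' setU0.
  have -> : D :\: B' = D by apply/setDidPl.
  apply/idP/idP => [/andP[_ /eqP <-]|CB']; first exact: subsetIr.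
  rewrite (subset_trans CB' B'B) (setIidPl CB') eqxx andbT /=.
  by have /eqP -> : C :\: B' == set0; rewrite ?setD_eq0 // set0U.
move=> /andP[_ /eqP CE]; rewrite mulrA -exprD; congr (_ ^+ _ * a _)%R.
  rewrite cardsU; have -> : C :&: D = set0.
    apply/setP => j; rewrite -CE !inE; have := disjointFr dDB (x := j); rewrite inE.
    by case: (j \in D); rewrite ?andbF // => ->; rewrite ?andbF.
  by rewrite cards0 subn0 addnC.
apply: eq_pack => j k.
have CB' i : i \in C -> w i = w j0 by rewrite -CE !inE => /andP[_ /eqP].
have DB' i : i \in D -> w i <> w j0 by move=> /(disjointFr dDB); rewrite inE => /eqP.
rewrite /split_word !inE; have := CB' j; have := CB' k; have := DB' j; have := DB' k.
by case: (j \in C); case: (j \in D); case: (k \in C); case: (k \in D) => /=; lia.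
Qed.

End CancellingSpace.

(** * Moebius inversion *)

Section MoebiusInversion.
Context {d : Order.disp_t} {T : finPOrderType d}.
Implicit Types x y z : T.
Local Open Scope ring_scope.

Lemma moebius_eq0 x y : ~~ (x <= y)%O -> moebius x y = 0.
Proof.
move=> xy; rewrite moebiusE; have [e|_] := eqVneq x y; first by rewrite e lexx in xy.
by rewrite lt_def (negbTE xy) andbF.
Qed.

Lemma sum_moebiusl x z : \sum_(y | (y <= z)%O) moebius x y = (x == z)%:R.
Proof.
rewrite (bigID (fun y => x <= y)%O) /= [X in _ + X]big1 ?addr0; last first.
  by move=> y /andP[_ /moebius_eq0].
have [<-|xz] := eqVneq x z.
  rewrite (big_pred1 x) => [|y]; last by rewrite -eq_le eq_sym.
  by rewrite moebiusE eqxx.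
have [le_xz|nle_xz] := boolP (x <= z)%O; last first.
  rewrite big1 // => y /andP[yz xy].
  by case/negP: nle_xz; apply: le_trans xy yz.
rewrite (bigD1 z) ?lexx //= moebiusE (negbTE xz) lt_def le_xz eq_sym xz /=.
rewrite addrC; apply/eqP; rewrite subr_eq0; apply/eqP/eq_bigl => y.
by rewrite lt_def [z == y]eq_sym; case: (x <= y)%O; case: (y <= z)%O; case: (y == z).
Qed.

(* [moebiusE] makes [moebius] a one-sided inverse of the zeta function in the *)
(* incidence algebra; the other side follows for square matrices.             *)
Lemma sum_moebiusr x z : \sum_(y | (x <= y)%O) moebius y z = (x == z)%:R.
Proof.
pose A := \matrix_(i < #|T|, j < #|T|) ((enum_val i <= enum_val j)%O%:R : int).
pose B := \matrix_(i < #|T|, j < #|T|) moebius (enum_val i) (enum_val j).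
have BA : B *m A = 1%:M.
  apply/matrixP => i j; rewrite !mxE -(inj_eq enum_val_inj) -sum_moebiusl.
  rewrite [RHS](reindex (@enum_val T T)) /=; last exact/onW_bij/enum_val_bij.
  rewrite [RHS]big_mkcond; apply: eq_bigr => k _; rewrite !mxE.
  by case: ifP; rewrite ?mulr1 ?mulr0.
have /matrixP/(_ (enum_rank x) (enum_rank z)) := mulmx1C BA.
rewrite !mxE (inj_eq enum_rank_inj) => <-.
rewrite (reindex (@enum_val T T)) /=; last exact/onW_bij/enum_val_bij.
rewrite big_mkcond; apply: eq_bigr => k _; rewrite !mxE !enum_rankK.
by case: ifP; rewrite ?mul1r ?mul0r.
Qed.

Lemma moebius_inversion (g : T -> rat) x :
  \sum_(y | (x <= y)%O) \sum_(z | (y <= z)%O) (moebius y z)%:~R * g z = g x.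
Proof.
transitivity (\sum_z (\sum_(y | (x <= y)%O) moebius y z)%:~R * g z).
  under [RHS]eq_bigr do rewrite rmorph_sum mulr_suml.
  rewrite [RHS]exchange_big; apply: eq_bigr => y _ /=.
  rewrite big_mkcond; apply: eq_bigr => z _; case: ifPn => // /moebius_eq0 ->.
  by rewrite mul0r.
rewrite (bigD1 x) //= sum_moebiusr eqxx mul1r big1 ?addr0 // => z zx.
by rewrite sum_moebiusr eq_sym (negbTE zx) mul0r.
Qed.

End MoebiusInversion.

(** * Counting the signs of eta *)

Section Count.
Variable n : nat.
Implicit Types (u v : 'I_n -> nat) (j k : 'I_n) (E : {set 'I_n}).
Implicit Types (phi psi chi zeta : setcomp n).

Definition ecoef phi psi : rat := if (psi <= phi)%O then (2 ^+ size psi)%R else 0%R.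

(* Admissibility for the increasingly labelled chain obtained by contracting  *)
(* each block of [phi] to a point.                                            *)
Definition block_admissible phi v : bool :=
  [forall j, forall k, ((blk phi j == blk phi k) ==> (v j == v k)) &&
    ((blk phi j < blk phi k) ==> (v j < v k) || (v j == v k) && odd (v j))].

(* A sign must be + on all the blocks of [phi] with the same letter, except   *)
(* on the first one, where it is free.                                        *)
Lemma sum_block_admissible phi u :
  (\sum_(E : {set 'I_n}) (block_admissible phi (split_word u E))%:R = ecoef phi (pack u))%R.
Proof.
rewrite /ecoef; case: ifPn => [/setcomp_leP le_u|nle]; last first.
  rewrite big1 // => E _; case: (boolP (block_admissible _ _)) => // /forallP adm.
  case/negP: nle; apply/setcomp_leP => j k; rewrite blk_pack_le.
  have := forallP (adm j) k; rewrite !split_word_lt.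
  rewrite /split_word; case: (j \in E); case: (k \in E); lia.
set psi := pack u in le_u *.
have u_lt j k : (u j < u k) = (blk psi j < blk psi k) by rewrite blk_pack_lt.
have u_eq j k : (u j == u k) = (blk psi j == blk psi k) by rewrite blk_pack_eq.
(* [F] collects the positions in the first block of [phi] inside their block of [psi]. [ext X] puts
   + outside [F], and on [F] the sign that [X] chooses freely for each block of [psi]. *)
pose F := [set j | [forall k, (blk psi k == blk psi j) ==> (blk phi j <= blk phi k)]].
have FP j : reflect (forall k, blk psi k = blk psi j -> blk phi j <= blk phi k) (j \in F).
  rewrite inE; apply: (iffP forallP) => H k; first by move=> /eqP; apply/implyP.
  by apply/implyP => /eqP; apply: H.
pose ext (X : {set 'I_(size psi)}) :=
  [set j | (j \notin F) || (Ordinal (blk_lt psi j) \in X)].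
have extE X j : (j \in ext X) = (j \notin F) || (Ordinal (blk_lt psi j) \in X) by rewrite in_set.
have onto (i : 'I_(size psi)) : exists2 j, j \in F & Ordinal (blk_lt psi j) = i.
  have [j0 j0i] := blk_onto (ltn_ord i).
  have [j /eqP ji j_min] := @arg_minnP _ j0 (fun j => blk psi j == i) (blk phi) (introT eqP j0i).
  exists j; last exact: val_inj.
  by apply/FP => k kj; apply: j_min; rewrite kj ji.
have ext_inj : injective ext.
  move=> X Y eXY; apply/setP => i; have [j jF <-] := onto i.
  by have /setP/(_ j) := eXY; rewrite !extE jF.
have adm_ext E : block_admissible phi (split_word u E) = (E \in [set ext X | X in predT]).
  apply/idP/imsetP => [/forallP adm|[X _ ->]].
    exists [set i | [exists j in F, (j \in E) && (Ordinal (blk_lt psi j) == i)]] => //.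
    apply/setP => j; rewrite extE; have [jF|jF] /= := boolP (j \in F).
      rewrite in_set; apply/idP/existsP => [jE|[k /andP[kF /andP[kE /eqP[ekj]]]]].
        by exists j; rewrite jF jE eqxx.
      have ejk : blk phi j = blk phi k.
        by apply/eqP; rewrite eqn_leq; apply/andP; split; apply: FP.
      have := forallP (adm j) k; rewrite ejk eqxx /split_word kE.
      have := u_eq k j; rewrite ekj eqxx; case: (j \in E); lia.
    have /forallPn[k] : ~~ [forall k, (blk psi k == blk psi j) ==> (blk phi j <= blk phi k)].
      by move: jF; rewrite inE.
    rewrite negb_imply -ltnNge => /andP[ekj lt].
    have := forallP (adm k) j; rewrite lt /split_word.
    have := u_eq k j; rewrite ekj; case: (j \in E); case: (k \in E) => //=;
      rewrite ?addn0 ?addn1 ?oddS ?odd_double; lia.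
  apply/forallP => j; apply/forallP => k.
  apply/andP; split; apply/implyP; [move=> /eqP e|move=> lt].
    have eps : blk psi j = blk psi k by apply/eqP; rewrite eqn_leq !le_u ?e.
    have eF : (j \in F) = (k \in F).
      by apply/FP/FP => H l; have := H l; rewrite eps e.
    rewrite /split_word; have /eqP -> : u j == u k by rewrite u_eq eps.
    rewrite eqn_add2l !extE eF.
    by have -> : Ordinal (blk_lt psi j) = Ordinal (blk_lt psi k) by apply: val_inj.
  rewrite split_word_lt -orbA; have := le_u j k (ltnW lt).
  rewrite leq_eqVlt -u_lt => /orP[e|->//]; have ujk : u j = u k by apply/eqP; rewrite u_eq.
  rewrite ujk ltnn eqxx /= odd_split_word.
  have kF : k \notin F.
    by apply/negP => /FP/(_ j (eqP e)); rewrite leqNgt lt.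
  have kX : k \in ext X by rewrite extE kF.
  by rewrite /split_word kX ujk; case: (j \in ext X); rewrite ?eqxx ?orbT.
under eq_bigr do rewrite adm_ext.
rewrite -natr_sum -big_mkcond /= sum1_card card_imset // -cardsT -powersetT card_powerset.
by rewrite cardsT card_ord natrX.
Qed.

End Count.

(** * The elements eta as alternating sums over labelled chains *)

Section Descents.
Variables (n : nat) (phi : setcomp n).
Implicit Types (u v : 'I_n -> nat) (j k : 'I_n) (s : {ffun 'I_n -> bool}).

Definition chain_pos j := blk phi j * n + j.

Definition chain_lt : rel 'I_n := [rel j k | chain_pos j < chain_pos k].

Lemma chain_ltE j k :
  chain_lt j k = (blk phi j < blk phi k) || (blk phi j == blk phi k) && (j < k).
Proof. exact: ltn_lex. Qed.

Lemma chain_pos_inj : injective chain_pos.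
Proof.
move=> j k e; apply: val_inj; apply/eqP.
have := chain_ltE j k; have := chain_ltE k j; rewrite /chain_lt /= e ltnn; lia.
Qed.

(* The labelling of the chain whose ascents end at the [k] such that [s k].   *)
Definition chain_label s j :=
  if s j then size phi * n + chain_pos j else size phi * n - chain_pos j.

Lemma chain_pos_lt j : chain_pos j < size phi * n.
Proof.
have : (blk phi j).+1 * n <= size phi * n by rewrite leq_mul2r blk_lt orbT.
by rewrite /chain_pos; have := ltn_ord j; lia.
Qed.

Lemma chain_label_lt s j k : chain_lt j k ->
  (chain_label s j < chain_label s k) = s k /\ (chain_label s k < chain_label s j) = ~~ s k.
Proof.
rewrite /chain_lt /chain_label /=; have := chain_pos_lt j; have := chain_pos_lt k.
by case: (s j); case: (s k); lia.
Qed.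

Lemma chain_label_inj s : injective (chain_label s).
Proof.
move=> j k e; apply: chain_pos_inj.
case: (ltngtP (chain_pos j) (chain_pos k)) => // /(chain_label_lt s);
  by rewrite e ltnn; case: (s _); case.
Qed.

Definition first_in_block k : bool :=
  [forall j, chain_lt j k ==> (blk phi j < blk phi k)].

(** A first element of a block must end an ascent, while any other counts ascent minus descent. The
    latter sums to zero unless the element is tied to an earlier one, which glues each block to a
    single letter. *)
Definition chain_weight k (b : bool) : rat :=
  (if b then 1 else if first_in_block k then 0 else -1)%R.

Definition tied v k : bool := [exists j, chain_lt j k && (v j == v k)].

(** Oddness of [phi] enters here: a block has an even number of non-first elements, all carrying the
    same sign. *)
Lemma prod_sign_nonfirst v : odd_blocks phi ->
  (forall j k, blk phi j = blk phi k -> v j = v k) ->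
  (\prod_(k | ~~ first_in_block k) (-1) ^+ (~~ odd (v k)) = 1 :> rat)%R.
Proof.
move=> odd_phi vE.
rewrite (partition_big (fun k => Ordinal (blk_lt phi k)) predT) //= big1 // => i _.
have [j0 j0i] := blk_onto (ltn_ord i).
have [f /eqP fi f_min] :=
  @arg_minnP _ j0 (fun j => blk phi j == i) chain_pos (introT eqP j0i).
have first_f j : blk phi j == i -> first_in_block j = (j == f).
  move=> /eqP ji; apply/forallP/eqP => [/(_ f)|-> k].
    rewrite fi ji ltnn implybF => H; apply: chain_pos_inj.
    by have := f_min j; rewrite ji eqxx => /(_ isT); move: H; rewrite /chain_lt /=; lia.
  apply/implyP => kf; move: (kf); rewrite chain_ltE => /orP[//|/andP[/eqP e _]].
  have := f_min k; rewrite e fi eqxx => /(_ isT).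
  by rewrite leqNgt /= => /negP[].
rewrite (eq_bigr (fun=> (-1) ^+ (~~ odd (v f))))%R; last first.
  by move=> k /andP[_ /eqP/(congr1 val)/= ki]; rewrite (vE k f) // ki.
rewrite (eq_bigl (mem ([set k | blk phi k == i] :\ f))); last first.
  move=> k; rewrite !inE -(inj_eq val_inj) /= andbC.
  by case: (boolP (blk phi k == i)) => [/first_f ->|]; rewrite ?andbF ?andbT.
have evB : ~~ odd #|[set k | blk phi k == i] :\ f|.
  have oddB : odd #|[set k | blk phi k == i]|.
    rewrite (_ : [set _ | _] = nth set0 phi i) ?(allP odd_phi) ?mem_nth //.
    by apply/setP => k; rewrite mem_blk inE eq_sym.
  by move: oddB; rewrite (cardsD1 f) inE fi eqxx add1n.
by rewrite prodr_const -exprM -signr_odd oddM (negbTE evB) andbF.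
Qed.

(** Admissibility means that [v] increases weakly along the chain and that [s k = odd (v k)] at
    every tied [k]. The second condition is independent over [k], so the sum over [s] factors. A
    first element yields the condition of [block_admissible] on ties; any other yields zero unless
    tied, and then a sign. Blocks are thus constant and the signs multiply to 1. *)
Lemma sum_chain_admissible v : odd_blocks phi ->
  (\sum_(s : {ffun 'I_n -> bool}) (\prod_k chain_weight k (s k)) * (admissible chain_lt (chain_label s) v)%:R
    = (block_admissible phi v)%:R)%R.
Proof.
move=> odd_phi.
pose mono := [forall j, forall k, chain_lt j k ==> (v j <= v k)].
have admE s : admissible chain_lt (chain_label s) v =
    mono && [forall k, tied v k ==> (s k == odd (v k))].
  apply/forallP/andP => [adm|[/forallP mon /forallP ties] j].
    split; apply/forallP; [move=> j|move=> k].
      by apply/forallP => k; apply/implyP => jk; have := forallP (adm j) k; rewrite jk; lia.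
    apply/implyP => /existsP[j /andP[jk /eqP vjk]]; have := forallP (adm j) k.
    have [-> ->] := chain_label_lt s jk.
    by rewrite jk vjk ltnn eqxx /=; case: (s k); case: (odd _).
  apply/forallP => k; apply/implyP => jk; have := forallP (mon j) k.
  rewrite jk leq_eqVlt => /orP[/eqP vjk|->//]; rewrite vjk ltnn eqxx /=.
  have [-> ->] := chain_label_lt s jk.
  have := ties k; have -> : tied v k by apply/existsP; exists j; rewrite jk vjk eqxx.
  by case: (s k); case: (odd _).
pose Z k (b : bool) : rat := (chain_weight k b * (tied v k ==> (b == odd (v k)))%:R)%R.
have -> : (\sum_(s : {ffun 'I_n -> bool}) (\prod_k chain_weight k (s k)) * (admissible chain_lt (chain_label s) v)%:R
    = mono%:R * \prod_k \sum_b Z k b)%R.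
  rewrite bigA_distr_bigA mulr_sumr; apply: eq_bigr => s _.
  rewrite big_split /= mulrCA; congr (_ * _)%R; rewrite admE -mulnb natrM; congr (_ * _)%R.
  case: (boolP [forall k, _]) => [/forallP H|/forallPn[k /negbTE H]].
    by rewrite big1 // => k _; rewrite H.
  by rewrite (bigD1 k) //= H mul0r.
have ZE k : (\sum_b Z k b = if first_in_block k then (tied v k ==> odd (v k))%:R
    else (tied v k)%:R * (-1) ^+ (~~ odd (v k)))%R.
  rewrite big_bool /Z /chain_weight /=.
  by case: (first_in_block k); case: (tied v k); case: (odd (v k)) => /=; ring.
have [/forallP mon|nmon] := boolP mono; last first.
  rewrite mul0r; case: (boolP (block_admissible phi v)) => // /forallP adm.
  case/negP: nmon; apply/forallP => j; apply/forallP => k; apply/implyP.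
  by have := forallP (adm j) k; rewrite chain_ltE; lia.
rewrite mul1r.
have [/forallP nf_tied|/forallPn[k]] := boolP [forall k, first_in_block k || tied v k]; last first.
  rewrite negb_or => /andP[nfk ntk].
  rewrite (bigD1 k) //= ZE (negbTE nfk) (negbTE ntk) !mul0r.
  case: (boolP (block_admissible phi v)) => // /forallP adm.
  case/negP: ntk; case/forallPn: nfk => j; rewrite negb_imply => /andP[jk nlt].
  apply/existsP; exists j; rewrite jk.
  have := forallP (adm j) k; move: jk; rewrite chain_ltE; lia.
have vE j k : blk phi j = blk phi k -> v j = v k.
  wlog jk : j k / chain_lt j k.
    move=> H e; case: (ltngtP (chain_pos j) (chain_pos k)) => jk; first exact: H.
      by symmetry; apply: H.
    by rewrite (chain_pos_inj jk).
  move=> e; apply/eqP; rewrite eqn_leq; apply/andP; split.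
    by have := forallP (mon j) k; rewrite jk.
  rewrite leqNgt; apply/negP => vjk.
  (* The earliest [i] of the block after [j] with a larger letter is not first, hence is tied to an
     earlier [l]; this [l] also satisfies [Q], against minimality. *)
  pose Q i := [&& blk phi i == blk phi j, chain_lt j i & v j < v i].
  have Qk : Q k by rewrite /Q e eqxx jk.
  have [i /and3P[/eqP ij ji vji] i_min] := arg_minnP chain_pos Qk.
  have /orP[/forallP/(_ j)|/existsP[l /andP[li /eqP vli]]] := nf_tied i.
    by rewrite ji ij ltnn.
  have jl : chain_lt j l.
    case: (ltngtP (chain_pos l) (chain_pos j)) => // [lj|/chain_pos_inj lj].
      by have := forallP (mon l) j; rewrite /chain_lt /= lj vli leqNgt vji.
    by rewrite -vli lj ltnn in vji.
  have : Q l.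
    rewrite /Q jl vli vji andbT /=; move: jl li; rewrite !chain_ltE ij; lia.
  by move=> /i_min; rewrite leqNgt => /negP[].
rewrite (bigID first_in_block) /= [X in (_ * X)%R](_ : _ = 1)%R ?mulr1; last first.
  apply: etrans (prod_sign_nonfirst odd_phi vE); apply: eq_bigr => k nfk.
  by rewrite ZE (negbTE nfk); have := nf_tied k; rewrite (negbTE nfk) => /= ->; rewrite mul1r.
have -> : block_admissible phi v = [forall (k | first_in_block k), tied v k ==> odd (v k)].
  apply/forallP/forallP => [adm k|H j].
    apply/implyP => /forallP fk; apply/implyP => /existsP[j /andP[jk /eqP vjk]].
    have := forallP (adm j) k; have := fk j; rewrite jk => /= ->.
    by rewrite vjk ltnn eqxx => /andP[].
  apply/forallP => k; apply/andP; split; apply/implyP; first by move=> /eqP/vE ->.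
  move=> lt; have jk : chain_lt j k by rewrite chain_ltE lt.
  have := forallP (mon j) k; rewrite jk leq_eqVlt => /orP[/eqP vjk|->//].
  rewrite vjk ltnn eqxx /=.
  have [f /eqP fk f_min] :=
    @arg_minnP _ k (fun i => blk phi i == blk phi k) chain_pos (eqxx _).
  have first_f : first_in_block f.
    apply/forallP => i; apply/implyP => fi; move: (fi).
    rewrite chain_ltE => /orP[//|/andP[/eqP e _]].
    by have := f_min i; rewrite e fk eqxx => /(_ isT); rewrite leqNgt => /negP[].
  have := H f; rewrite first_f (vE f k fk) => /= /implyP; apply.
  by apply/existsP; exists j; rewrite chain_ltE fk lt (vE f k fk) vjk /=.
case: (boolP [forall (k | _), _]) => [/forallP H|/forallPn[k]].
  by rewrite big1 // => k fk; rewrite ZE fk; have := H k; rewrite fk /= => ->.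
rewrite negb_imply => /andP[fk H].
by rewrite (bigD1 k) //= ZE fk (negbTE H) mul0r.
Qed.

Lemma ecoef_Kcoef u : odd_blocks phi ->
  (ecoef phi (pack u) =
    \sum_(s : {ffun 'I_n -> bool}) (\prod_k chain_weight k (s k)) * Kcoef chain_lt (chain_label s) u)%R.
Proof.
move=> odd_phi; rewrite -sum_block_admissible.
under eq_bigr do rewrite -sum_chain_admissible //.
by rewrite exchange_big; apply: eq_bigr => s _; rewrite mulr_sumr.
Qed.

Lemma ecoef_cancelling : odd_blocks phi -> cancelling (ecoef phi).
Proof.
move=> odd_phi; have := cancelling_sum (fun s : {ffun 'I_n -> bool} => (\prod_k chain_weight k (s k))%R)
  (fun s => Kcoef_cancelling chain_lt (@chain_label_inj s)).
by apply: eq_cancelling => psi; rewrite -{2}(pack_blk psi) ecoef_Kcoef.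
Qed.

End Descents.

(** * Series *)

Local Open Scope ring_scope.

Definition word_fun n (w : seq nat) (j : 'I_n) : nat := nth 0%N w j.

Lemma M_wordE n (phi : setcomp n) (w : seq nat) :
  M_word phi w = (size w == n) && all (leq 1) w && (pack (@word_fun n w) == phi).
Proof.
rewrite -andbA; congr [&& _, _ & _]; apply/forallP/eqP => [H|<- j].
  apply: setcomp_eqP => j k; rewrite blk_pack_le leqNgt [RHS]leqNgt; congr negb.
  by have /andP[_ /eqP] := forallP (H k) j.
by apply/forallP => k; rewrite blk_pack_lt blk_pack_eq !eqxx.
Qed.

Section MSeries.
Variable n : nat.
Implicit Types (phi psi chi : setcomp n) (a : setcomp n -> rat).

Definition mseries a : ncseries := \sum_phi a phi *: M phi.

Lemma mseries_word a (w : seq nat) :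
  mseries a w = if (size w == n) && all (leq 1) w then a (pack (@word_fun n w)) else 0.
Proof.
rewrite /mseries fct_sumE.
under eq_bigr => phi _ do rewrite /= -[(_ *: M phi) w]/(a phi * (M_word phi w)%:R) M_wordE.
case: ifP => ww; last by rewrite big1 // => phi _; rewrite mulr0.
rewrite (bigD1 (pack (@word_fun n w))) //= eqxx mulr1 big1 ?addr0 // => phi ne.
by rewrite eq_sym (negbTE ne) mulr0.
Qed.

Lemma mseries_sum (T : finType) (c : T -> rat) (a : T -> setcomp n -> rat) :
  mseries (fun phi => \sum_i c i * a i phi) = \sum_i c i *: mseries (a i).
Proof.
rewrite /mseries; under [RHS]eq_bigr do rewrite scaler_sumr.
rewrite exchange_big; apply: eq_bigr => phi _; rewrite scaler_suml.
by apply: eq_bigr => i _; rewrite scalerA.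
Qed.

Lemma Delta_sum (T : finType) (c : T -> rat) (f : T -> ncseries) :
  Delta (\sum_i c i *: f i) = \sum_i c i *: Delta (f i).
Proof.
have Delta0 : Delta 0 = 0.
  by have := Delta_linear (- 1) 0 0; rewrite scaler0 addr0 scaleN1r addNr.
by elim/big_rec2: _ => // i y1 y2 _ <-; exact: Delta_linear.
Qed.

(** Grouping the pairs by their left factor makes the coproduct act on coefficient functions. *)
Lemma Delta_mseries a :
  Delta (mseries a) = \sum_psi (M psi ⊗ mseries (fun chi => a (wedge psi chi))).
Proof.
rewrite Delta_sum; apply/funext => u; apply/funext => v.
rewrite !fct_sumE.
transitivity (\sum_psi \sum_chi a (wedge psi chi) * (M psi u * M chi v)).
  rewrite pair_big /= [RHS](partition_big (fun p => wedge p.1 p.2) predT) //=.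
  apply: eq_bigr => phi _; rewrite Delta_M.
  transitivity (a phi * (\sum_(p | wedge p.1 p.2 == phi) (M p.1 ⊗ M p.2)) u v) => //.
  rewrite !fct_sumE mulr_sumr; apply: eq_bigr => p /eqP <- //.
apply: eq_bigr => psi _; rewrite /tens /mseries fct_sumE mulr_sumr.
by apply: eq_bigr => chi _; rewrite mulrCA.
Qed.

Lemma eta_mseries (phi : oddcomp n) :
  eta phi = mseries (fun psi => (-1) ^+ pexp phi * ecoef phi psi).
Proof.
rewrite /eta /mseries scaler_sumr [LHS]big_mkcond; apply: eq_bigr => psi _.
by rewrite /ecoef; case: ifP; rewrite ?mulr0 ?scale0r ?scalerA.
Qed.

(** At an odd [zeta], expanding [a] in the [ecoef chi] says that [a zeta / 2 ^+ size zeta] is the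
    sum of the coefficients of all [chi] above [zeta]; this is the Moebius inverse. *)
Definition eta_coef a (chi : oddcomp n) : rat :=
  \sum_(zeta | (chi <= zeta)%O) (moebius chi zeta)%:~R * (a zeta / 2 ^+ size zeta).

Lemma cancelling_ecoef a : cancelling a ->
  forall phi, a phi = \sum_chi eta_coef a chi * ecoef (oddcomp_val chi) phi.
Proof.
move=> ca phi; apply/eqP; rewrite -subr_eq0; apply/eqP; move: phi.
apply: cancelling_eq0 => [u m hm|phi odd_phi].
  under eq_bigr do rewrite mulrBr.
  rewrite big_split /= sumrN ca // sub0r.
  have := cancelling_sum (eta_coef a)
    (fun chi : oddcomp n => ecoef_cancelling (oddcompP chi)).
  by move=> /(_ u m hm) ->; rewrite oppr0.
pose x := OddComp odd_phi; rewrite (_ : phi = x) //.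
under eq_bigr do rewrite /ecoef -oddcomp_leE (fun_if (fun t => _ * t)) mulr0.
rewrite -big_mkcond -mulr_suml /= moebius_inversion divfK ?subrr //.
by rewrite expf_eq0 andbF.
Qed.

Lemma cancelling_eta a : cancelling a ->
  mseries a = \sum_(chi : oddcomp n) ((-1) ^+ pexp chi * eta_coef a chi) *: eta chi.
Proof.
move=> ca; transitivity (mseries (fun phi => \sum_(chi : oddcomp n)
    ((-1) ^+ pexp chi * eta_coef a chi) * ((-1) ^+ pexp chi * ecoef chi phi))).
  congr mseries; apply/funext => phi; rewrite (cancelling_ecoef ca).
  by apply: eq_bigr => chi _; rewrite mulrACA -expr2 sqrr_sign mul1r.
by rewrite mseries_sum; apply: eq_bigr => chi _; rewrite eta_mseries.
Qed.

End MSeries.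

(** * The series [K] in coordinates, and [eta] inside [NCPi] *)

Definition letter (p : nat) (e : bool) : int := if e then p%:Z else - p%:Z.

Lemma letter_enriched (p q : nat) (e d P Q : bool) : (0 < p)%N -> (0 < q)%N ->
  [/\ enriched_le (letter p e) (letter q d),
      letter p e = letter q d -> 0 < letter p e -> P
    & letter p e = letter q d -> letter p e < 0 -> Q] <->
  (p.*2 + e < q.*2 + d)%N || (p.*2 + e == q.*2 + d)%N && (if e then P else Q).
Proof.
move=> p0 q0; rewrite /enriched_le /letter; case: e; case: d => /=; split=> [[]|H]; by [lia|split; lia].
Qed.

(** A function read as [w] has its absolute values fixed by [w], so it amounts to the set [E] of
    positions where it is positive, and [letter_enriched] turns the enriched conditions into
    admissibility. Words with a zero letter or of the wrong length are read by no function. *)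
Lemma K_mseries d (P : finPOrderType d) n (gamma sigma : P -> 'I_n) (tau : 'I_n -> P) :
  cancel sigma tau -> cancel tau sigma ->
  K gamma sigma = mseries (fun phi : setcomp n =>
    Kcoef [rel j k | (tau j < tau k)%O] (fun j => gamma (tau j)) (blk phi)).
Proof.
move=> sigK tauK; apply/funext => w; rewrite mseries_word Kcoef_pack.
set R := [rel j k | _]; set g := fun j => _; set u := @word_fun n w.
case: ifPn => [/andP[/eqP sw /allP w0]|ww]; last first.
  apply: fsbig1 => f [[f0 _] [sw fw]]; case/negP: ww; rewrite sw eqxx /=.
  apply/allP => _ /(nthP 0%N)[i lt <-]; rewrite sw in lt.
  have := fw (tau (Ordinal lt)); rewrite tauK /= => ->.
  by rewrite absz_gt0 f0.
have u0 j : (0 < u j)%N by apply: w0; apply: mem_nth; rewrite sw.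
pose f (E : {set 'I_n}) := [ffun a => letter (u (sigma a)) (sigma a \in E)].
have f_inj : injective f.
  move=> E E' /ffunP eE; apply/setP => j; have := eE (tau j); rewrite !ffunE tauK.
  by have := u0 j; rewrite /letter; case: (j \in E); case: (j \in E'); lia.
pose r := [seq f E | E <- enum [pred E | admissible R g (split_word u E)]].
have adm_f E : enriched_partition gamma (f E) <-> admissible R g (split_word u E).
  split=> [[_ H]|/forallP H].
    apply/forallP => j; apply/forallP => k; apply/implyP => /H.
    by rewrite !ffunE !tauK odd_split_word => /letter_enriched; apply.
  split=> [a|a b ab].
    by rewrite ffunE /letter; have := u0 (sigma a); case: (_ \in _); lia.
  have := forallP (H (sigma a)) (sigma b); rewrite /R /g /= !sigK ab odd_split_word !ffunE.
  by move=> ?; apply/letter_enriched.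
rewrite /K (_ : [set f | _]%classic = [set` r]%classic) -?fsbig_seq; last 2 first.
- by rewrite map_inj_uniq ?enum_uniq.
- apply/seteqP; split=> h /=.
    move=> [hadm [_ hw]]; apply/mapP; pose E := [set j | 0 < h (tau j)].
    have hE : h = f E.
      apply/ffunP => a; rewrite ffunE inE sigK /u /word_fun hw /letter.
      by move: (h a) => z; case: ltP; lia.
    by exists E => //; rewrite mem_enum inE; apply/adm_f; rewrite -hE.
  move=> /mapP[E]; rewrite mem_enum inE => /adm_f hadm ->; split=> //; split=> // a.
  by rewrite ffunE /letter /u /word_fun; case: (_ \in _); lia.
rewrite big_map big_enum_cond /= /Kcoef big_mkcond; apply: eq_bigr => E _.
by rewrite inE; case: admissible.
Qed.

(** Labels of [K] must lie in ['I_n], whereas [chain_pos] and [chain_label] may exceed [n]; ranks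
    keep their relative order. *)
Lemma rank_exists n (h : 'I_n -> nat) : injective h ->
  exists2 r : 'I_n -> 'I_n, bijective r & forall j k, (r j < r k)%N = (h j < h k)%N.
Proof.
move=> h_inj.
have lt j : (#|[set i | (h i < h j)%N]| < n)%N.
  rewrite -[X in (_ < X)%N]card_ord -cardsT; apply/proper_card/properP.
  by split; [exact: subsetT | exists j; rewrite !inE ?ltnn].
pose r j := Ordinal (lt j).
have mono j k : (h j < h k)%N -> (r j < r k)%N.
  move=> jk; apply/proper_card/properP; split.
    by apply/subsetP => i; rewrite !inE => ij; apply: ltn_trans jk.
  by exists j; rewrite !inE ?ltnn.
have rE j k : (r j < r k)%N = (h j < h k)%N.
  case: (ltngtP (h j) (h k)) => [/mono //|/mono kj|/h_inj ->]; last by rewrite ltnn.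
  by apply/negbTE; rewrite -leqNgt ltnW.
exists r => //; apply: injF_bij => j k e; apply: h_inj.
by case: (ltngtP (h j) (h k)) => // /mono; rewrite e ltnn.
Qed.

Local Open Scope classical_set_scope.

Lemma eta_NCPi n (phi : oddcomp n) : NCPi (eta phi).
Proof.
have [t [tau' tK t'K] tE] := rank_exists (@chain_pos_inj n phi).
have [G G_bij GE] : exists2 G : {ffun 'I_n -> bool} -> 'I_n -> 'I_n,
    forall s, bijective (G s)
  & forall s j k, (G s j < G s k)%N = (chain_label phi s j < chain_label phi s k)%N.
  have /choice[G GP] : forall s, exists r : 'I_n -> 'I_n, bijective r /\
      forall j k, (r j < r k)%N = (chain_label phi s j < chain_label phi s k)%N.
    by move=> s; have [r ? ?] := rank_exists (@chain_label_inj n phi s); exists r.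
  by exists G => s; have [] := GP s.
(* The poset is ['I_n] with its usual order, seen as the set of ranks in the chain; [tau'] sends a
   rank to its position. *)
rewrite (_ : eta phi = \sum_(s : {ffun 'I_n -> bool})
  ((-1) ^+ pexp phi * \prod_k chain_weight phi k (s k)) *: K (G s \o tau') tau').
  apply: linspan_sum => s _; rewrite -[_ *: _]addr0.
  apply: linspan_comb; last exact: linspan0.
  apply: linspan_gen; exists n, _, 'I_n, (G s \o tau'), tau'; split=> //.
    by apply: bij_comp => //; exists t.
  by exists t.
under eq_bigr do rewrite (K_mseries _ t'K tK).
rewrite -mseries_sum eta_mseries; congr mseries; apply/funext => psi.
rewrite -{1}(pack_blk psi) ecoef_Kcoef ?oddcompP // mulr_sumr.
apply: eq_bigr => s _; rewrite mulrA; congr (_ * _).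
by apply: eq_Kcoef => j k /=; rewrite ?tK ?GE // ltEord tE.
Qed.

Lemma cancelling_NCPi n (a : setcomp n -> rat) : cancelling a -> NCPi (mseries a).
Proof.
move=> /cancelling_eta ->; apply: linspan_sum => chi _; rewrite -[_ *: _]addr0.
by apply: linspan_comb; [exact: eta_NCPi | exact: linspan0].
Qed.

(** The division by [2 ^+ size zeta] in [eta_coef] produces the exponent in [Ccoef], and [below_CCE]
    gives the range of summation. *)
Lemma eta_coef_wedge n (phi : oddcomp n) (psi : setcomp n) (chi : oddcomp n) :
  ((-1) ^+ pexp chi *
    eta_coef (fun zeta => (-1) ^+ pexp phi * ecoef phi (wedge psi zeta)) chi =
  if below_CC phi psi chi then Ccoef phi psi chi else 0)%R.
Proof.
have -> : (eta_coef (fun zeta => (-1) ^+ pexp phi * ecoef phi (wedge psi zeta)) chi =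
    (-1) ^+ pexp phi * \sum_(zeta : oddcomp n | (chi <= zeta)%O && below_CC phi psi zeta)
      (moebius chi zeta)%:~R * 2%:Q ^ ((size (wedge psi zeta))%:Z - (size zeta)%:Z))%R.
  rewrite /eta_coef mulr_sumr [RHS]big_mkcondr; apply: eq_bigr => zeta _.
  rewrite /ecoef -below_CCE; case: ifP => _; last by rewrite mulr0 mul0r mulr0.
  by rewrite expfzDr // -exprnP -exprnN -[(_ * _) / _]mulrA mulrCA.
rewrite mulrA -exprD -/(Ccoef phi psi chi); case: ifPn => // nbelow.
(* [below_CC] passes to coarser compositions, so the sum is empty when it fails at [chi]. *)
rewrite /Ccoef big1 ?mulr0 // => zeta /andP[le].
move=> /existsP[xi /andP[xiC zxi]]; case/negP: nbelow; apply/existsP; exists xi.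
by rewrite xiC (le_trans _ zxi) -?oddcomp_leE.
Qed.

Theorem theorem12p1 :
  (forall (n : nat) (phi : oddcomp n),
     Delta (eta phi) =
       \sum_(psi : setcomp n | (psi <= oddcomp_val phi)%O)
         (M psi ⊗
            \sum_(chi : oddcomp n | below_CC phi psi chi)
              Ccoef phi psi chi *: eta chi))
  /\ Delta @` NCPi `<=` tens_space NCQSym NCPi.
Proof.
split=> [n phi|_ [_ [m [c [s [sK ->]]]] <-]].
  rewrite eta_mseries Delta_mseries [RHS]big_mkcond; apply: eq_bigr => psi _.
  case: ifPn => [le|nle].
    have cb : cancelling (fun chi => (-1) ^+ pexp phi * ecoef phi (wedge psi chi)).
      exact/cancellingZ/cancelling_wedge/ecoef_cancelling/oddcompP.
    congr (_ ⊗ _); rewrite (cancelling_eta cb) [RHS]big_mkcond.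
    apply: eq_bigr => chi _; rewrite eta_coef_wedge.
    by case: ifP; rewrite ?scale0r.
  (* Since [psi] is coarser than [wedge psi chi], a [psi] not below [phi] contributes nothing. *)
  have -> : mseries (fun chi => (-1) ^+ pexp phi * ecoef phi (wedge psi chi)) = 0.
    apply: big1 => chi _; rewrite /ecoef ifN ?mulr0 ?scale0r //.
    by apply: contra nle; apply: le_trans; apply: le_wedgel.
  by apply/funext => u; apply/funext => v; apply: mulr0.
rewrite Delta_sum; apply: linspan_sum => i _; have [n [d [P [gamma [sigma]]]]] := sK i.
move=> [gamma_bij [tau sigK tauK] ->]; rewrite (K_mseries _ sigK tauK) Delta_mseries.
rewrite -[_ *: _]addr0; apply: linspan_comb; last exact: linspan0.
apply: linspan_sum => psi _; apply: linspan_gen.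
exists (M psi); first by apply: linspan_gen; exists n, psi.
eexists; last reflexivity.
have label_inj : injective (fun j => gamma (tau j) : nat).
  by move=> j k /val_inj/(bij_inj gamma_bij)/(can_inj tauK).
exact: (cancelling_NCPi (cancelling_wedge psi (Kcoef_cancelling _ label_inj))).
Qed.
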